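(* Let $S=(S_n)_{n\ge0}$ be a random walk in $\mathbb{Z}^d$ with $S_0=0$ and i.i.d. increments $X_n=S_n-S_{n-1}$, $n\ge1$. Assume that one of the following holds: (i) $d=2$, $X_1$ is centered with finite and non-singular covariance matrix, and the walk is aperiodic in the sense that the characteristic function $\varphi$ of $S_1$ satisfies $\varphi(u)=1$ if and only if $u\in2\pi\mathbb{Z}^2$; or (ii) $d\ge1$ and the random walk $S$ is transient. Let $(\xi_x)_{x\in\mathbb{Z}^d}$ be i.i.d. standard Gaussian $\mathcal N(0,1)$ random variables, independent of $S$, and let $Z_0:=0$, $Z_n:=\sum_{i=1}^n\xi_{S_i}$ for $n\ge1$. Then there exists a constant $c>0$ such that for all large enough $T\in\mathbb{N}$ $$T^{-1/2}\,e^{-c\sqrt{\log T}}\ \le\ \mathbb{P}\Big[\max_{k=1,\ldots,T}Z_k\le0\Big]\ \le\ T^{-1/2}\,(\log T)^{c}.$$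
   Context: $\mathbb{P}$ denotes the joint law of the random walk $S$ and the scenery $\xi$. The process $(Z_n)$ is called a random walk in random scenery. *)

(* Defs.v *)
From HB Require Import structures.
From mathcomp Require Export all_boot all_order all_algebra.
From mathcomp Require Export finmap.
From mathcomp Require Export all_classical all_reals all_analysis.
From mathcomp Require Import complex.

Set Implicit Arguments.
Unset Strict Implicit.
Unset Printing Implicit Defensive.

Import Order.TTheory GRing.Theory Num.Theory.
Import numFieldNormedType.Exports.

Local Open Scope classical_set_scope.
Local Open Scope ring_scope.

(* An alias of 'rV[int]_d, so that the discrete sigma-algebra below is not put
   on the matrix type itself. *)
Definition lattice (d : nat) : Type := 'rV[int]_d.

HB.instance Definition _ (d : nat) := GRing.Zmodule.on (lattice d).
HB.instance Definition _ (d : nat) := Countable.on (lattice d).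
HB.instance Definition _ (d : nat) := isPointed.Build (lattice d) 0.
HB.instance Definition _ (d : nat) :=
  @isMeasurable.Build default_measure_display (lattice d)
    discrete_measurable discrete_measurable0
    (@discrete_measurableC _) (@discrete_measurableU _).

Section independence.
Context {dT dE : measure_display} {T : measurableType dT}
  {E : measurableType dE} {R : realType}.
Implicit Type P : probability T R.

Definition mutually_independent P (I : choiceType) (X : I -> T -> E) : Prop :=
  forall (J : {fset I}) (B : I -> set E),
    (forall j, j \in J -> measurable (B j)) ->
    P (\bigcap_(j in [set` J]) (X j @^-1` B j))
      = (\prod_(j <- J) P (X j @^-1` B j))%E.

Definition identically_distributed P (I : choiceType) (X : I -> T -> E) : Prop :=
  forall (i j : I) (B : set E), measurable B ->
    P (X i @^-1` B) = P (X j @^-1` B).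

Definition iid P (I : choiceType) (X : I -> T -> E) : Prop :=
  mutually_independent P X /\ identically_distributed P X.

Definition sigma_of (I : Type) (X : I -> T -> E) : set (set T) :=
  <<s \bigcup_i preimage_set_system setT (X i) measurable >>.

End independence.

Definition independent_families {dT dE dF : measure_display}
    {T : measurableType dT} {E : measurableType dE} {F : measurableType dF}
    {R : realType} (P : probability T R) (I J : Type)
    (X : I -> T -> E) (Y : J -> T -> F) : Prop :=
  forall A B : set T, sigma_of X A -> sigma_of Y B ->
    P (A `&` B) = (P A * P B)%E.

Section walk.
Context {dT : measure_display} {T : measurableType dT} {R : realType}
  (P : probability T R) (d : nat).
Implicit Types (S : nat -> T -> lattice d) (X : T -> lattice d).

(* X_n = S_n - S_(n-1); used for n >= 1 only, as 0.-1 = 0 makes it 0 at n = 0. *)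
Definition increment S (n : nat) (w : T) : lattice d := S n w - S n.-1 w.

Definition random_walk S : Prop :=
  (forall w, S 0%N w = 0) /\ iid P (fun n => increment S n.+1).

Definition transient S : Prop :=
  (P [set w | exists n, (0 < n)%N /\ S n w = 0%R] < 1)%E.

Definition coord (i : 'I_d) X (w : T) : R := ((X w : 'rV[int]_d) 0 i)%:~R.

Definition centered X : Prop := forall i : 'I_d, ('E_P[coord i X] = 0)%E.

Definition finite_covariance X : Prop :=
  forall i : 'I_d, coord i X \in Lfun P 2%:E.

(* [fine] loses nothing under [finite_covariance X]. *)
Definition covariance_mx X : 'M[R]_d :=
  \matrix_(i, j) fine (covariance P (coord i X) (coord j X)).

Definition complex_expectation (f : T -> R[i]) : R[i] :=
  Complex (fine 'E_P[fun w => complex.Re (f w)])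
          (fine 'E_P[fun w => complex.Im (f w)]).

Definition expi (t : R) : R[i] := Complex (cos t) (sin t).

Definition char_fun X (u : 'rV[R]_d) : R[i] :=
  complex_expectation (fun w => expi (\sum_(i < d) u 0 i * coord i X w)).

Definition aperiodic X : Prop :=
  forall u : 'rV[R]_d, char_fun X u = 1 <->
    exists k : 'rV[int]_d, u = (2 * pi) *: map_mx intr k.

End walk.

Definition rwrs {dT : measure_display} {T : measurableType dT} {R : realType}
    (d : nat) (xi : lattice d -> T -> R) (S : nat -> T -> lattice d)
    (n : nat) (w : T) : R :=
  \sum_(1 <= i < n.+1) xi (S i w) w.

(* The maximum of f 1, ..., f n for n >= 1; the bigop needs a starting value,
   and f 1 is neutral as it is one of the terms. *)
Definition max_upto {R : realType} (f : nat -> R) (n : nat) : R :=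
  \big[Order.max/f 1%N]_(1 <= k < n.+1) f k.

(* Main.v *)
Require Import Defs.
From HB Require Import structures.
From mathcomp Require Import measurable_realfun.
From mathcomp Require Import ring lra zify.

Set Implicit Arguments.
Unset Strict Implicit.
Unset Printing Implicit Defensive.

Import Order.TTheory GRing.Theory Num.Theory.
Import numFieldNormedType.Exports.
Local Open Scope classical_set_scope.
Local Open Scope ring_scope.

(** Let Z_0 = 0, and write M_n for the maximum of Z_0, ..., Z_n and L_n for the
   maximum of Z_1, ..., Z_n. The scenery seen from the walker is stationary, so
   L_(n+1) is xi(S_1) plus a copy of M_n, while M_(n+1) = max(0, L_(n+1)). Since
   xi(S_1) is centred, taking means gives

     E M_(n+1) - E M_n = E [max(0, - L_(n+1))],

   and the right-hand side decreases with n because L_n increases with n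
   (mean_runmaxS and mean_overshoot_le). Thus E M_n is concave in n, and bounds
   on E M_n give bounds on its increments.

   Size of E M_n. Given the walk, Z_k is a centred Gaussian variable whose
   variance V_k counts the pairs of times up to k at which the walk is at the
   same site. As V_n >= n, E M_n is at least a constant times sqrt n
   (integral_runmax_ge). An exponential union bound over k <= n gives the mean
   of M_n given the walk to be at most (ln n + 2) sqrt V_n (integral_runmax_le),
   and E V_n <= 2 n G_n, where G_n is the sum of P(S_k = 0) over k < n. If the
   walk is transient then G_n is bounded (transient_green_le). If d = 2 and the
   covariance is non-singular, then the step charges three points that are not
   on a line; a positive fraction of the steps can then be resampled as fair
   choices in two linearly independent directions, whence P(S_k = 0) = O(1/k)
   and G_n = O(ln n) (planar_green_le). In both cases E M_n is sqrt n up to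
   powers of ln n, and so E [max(0, - L_n)] is n^(-1/2) up to powers of ln n.

   From the overshoot to the probability. On the one hand L_n >= xi(S_1), so
   that on the event L_n <= 0 the overshoot - L_n is at most - xi(S_1), which is
   at most ln n outside an event of negligible cost
   (mean_overshoot_le_persistence). On the other hand lowering the single
   variable xi(S_1) by 1 / ln n lowers every Z_k with k >= 1 by at least as much,
   because the site S_1 is counted in each of them; this changes the Gaussian
   density by a bounded factor only, up to a negligible tail. So the events
   L_n <= 0 and L_n <= - 1 / ln n have comparable probabilities, and the latter
   is at most ln n times the mean overshoot (persistence_le_mean_overshoot).

   Both bounds hold in this way with powers of ln n; such a power is absorbed by
   exp(c sqrt(ln n)) in the lower bound (persistence_bounds).

   All laws are transported to two canonical spaces: the space of sceneries and
   the space of sequences of steps, with the sigma-algebra generated by the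
   coordinates. There the law of an i.i.d. family is determined by its values on
   finite boxes, which gives invariance and resampling by a change of box. *)

(** * Product spaces and families of independent variables *)

Section product_space.
Context {dE : measure_display} {E : measurableType dE} (I : choiceType).

Definition cylinders : set (set (I -> E)) :=
  \bigcup_i preimage_set_system setT (fun f : I -> E => f i) measurable.

Definition product_space := g_sigma_algebraType cylinders.
HB.instance Definition _ := Measurable.on product_space.

Definition box (J : {fset I}) (B : I -> set E) : set product_space :=
  [set f | forall i, i \in J -> B i (f i)].

Lemma measurable_coordinate i :
  measurable_fun setT (fun f : product_space => f i).
Proof.
move=> _ B mB; apply: sub_sigma_algebra; exists i => //.
by exists B.
Qed.

Lemma measurable_product_space d (T : measurableType d)
    (F : T -> product_space) :
  (forall i, measurable_fun setT (fun w => F w i)) -> measurable_fun setT F.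
Proof.
move=> mF; apply: (@measurability _ _ _ _ _ F cylinders) => //.
move=> _ [_ [i _ [B mB <-]] <-].
have := mF i measurableT B mB.
by rewrite !setTI.
Qed.

Lemma measurable_box J B : (forall i, measurable (B i)) -> measurable (box J B).
Proof.
move=> mB; rewrite /box.
have -> : [set f : product_space | forall i, i \in J -> B i (f i)] =
    \bigcap_(i in [set` J]) ((fun f : product_space => f i) @^-1` B i) by [].
apply: fin_bigcap_measurable => // i _.
rewrite -[X in measurable X]setTI; exact: measurable_coordinate.
Qed.

(** Boxes over finite index sets are closed under intersection and generate the
   sigma-algebra, so this is the uniqueness part of the pi-lambda theorem. *)
Lemma product_space_measure_unique (R : realType)
    (m1 m2 : {measure set product_space -> \bar R}) :
  (m1 setT < +oo)%E ->
  (forall J B, (forall i, measurable (B i)) -> m1 (box J B) = m2 (box J B)) ->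
  forall A, measurable A -> m1 A = m2 A.
Proof.
move=> m1T m12.
pose G := [set A | exists J B, (forall i, measurable (B i)) /\ A = box J B].
have GT : G setT.
  exists fset0, (fun=> setT); split => //.
  by apply/seteqP; split.
apply: (measure_unique G (fun=> setT)) => //.
- apply/seteqP; split.
    apply: smallest_sub; first exact: smallest_sigma_algebra.
    move=> _ [i _ [B mB <-]]; apply: sub_sigma_algebra.
    exists [fset i]%fset, (fun=> B); split => //.
    apply/seteqP; split => f /=.
      by move=> [_ Bf] j; rewrite inE => /eqP ->.
    by move=> h; split => //; apply: h; rewrite inE.
  apply: smallest_sub; first exact: sigma_algebra_measurable.
  by move=> _ [J [B [mB ->]]]; exact: measurable_box.
- move=> _ _ [J1 [B1 [mB1 ->]]] [J2 [B2 [mB2 ->]]].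
  exists (J1 `|` J2)%fset, (fun i => (if i \in J1 then B1 i else setT) `&`
    (if i \in J2 then B2 i else setT)); split.
    by move=> i; apply: measurableI; case: ifP.
  apply/seteqP; split => f /=.
    by move=> [h1 h2] i _; split; case: ifPn => // ?; [exact: h1|exact: h2].
  move=> h; split => i iJ; have := h i; rewrite inE iJ ?orbT => /(_ isT) [] //.
- by rewrite bigcup_const.
- by move=> _ [J [B [mB ->]]]; exact: m12.
Qed.

End product_space.
Arguments product_space {dE} E I.

Section countable_arguments.
Context {n : nat} {d d2 : measure_display} {T : measurableType d}
  {T2 : measurableType d2}.

Lemma measurable_lattice_fun (f : lattice n -> T2) : measurable_fun setT f.
Proof. by move=> _ B _; rewrite setTI. Qed.

(** A countable union over the value taken by the discrete argument. *)
Lemma measurable_select (g : T -> lattice n) (h : lattice n -> T -> T2) :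
  measurable_fun setT g -> (forall c, measurable_fun setT (h c)) ->
  measurable_fun setT (fun w => h (g w) w).
Proof.
move=> mg mh _ B mB; rewrite setTI.
have -> : (fun w => h (g w) w) @^-1` B =
    \bigcup_c (g @^-1` [set c] `&` h c @^-1` B).
  apply/seteqP; split => w /=; first by exists (g w).
  by move=> [c _ [/= <-]].
apply: countable_bigcupT_measurable; first exact: countableP.
move=> c; apply: measurableI.
  by rewrite -[X in measurable X]setTI; apply: mg.
by rewrite -[X in measurable X]setTI; apply: mh.
Qed.

End countable_arguments.

Lemma measurable_latticeD n d (T : measurableType d) (f g : T -> lattice n) :
  measurable_fun setT f -> measurable_fun setT g ->
  measurable_fun setT (fun w => f w + g w).
Proof.
move=> mf mg; apply: (measurable_select (h := fun c w => c + g w)) => // c.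
apply: (measurableT_comp (f := fun y : lattice n => c + y)) => //.
Qed.

Lemma measurable_latticeN n d (T : measurableType d) (f : T -> lattice n) :
  measurable_fun setT f -> measurable_fun setT (fun w => - f w).
Proof.
move=> mf; apply: (measurableT_comp (f := fun y : lattice n => - y)) => //.
Qed.

Lemma integral_prob_cst d (T : measurableType d) (R : realType)
    (m : probability T R) (c : \bar R) :
  (\int[m]_x c = c)%E.
Proof.
rewrite (integral_cst m measurableT c) -[RHS]mule1; congr (_ * _)%E.
exact: probability_setT.
Qed.

Section law_transfer.
Context {dE d : measure_display} {E : measurableType dE} {I : choiceType}
  {R : realType} {T : measurableType d}.

(** An equality of laws is checked on boxes, and used as a change of variables
   for nonnegative integrands. *)
Lemma integral_law_eq (m : probability (product_space E I) R)
    (m0 : {measure set T -> \bar R}) (phi : T -> product_space E I) :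
  measurable_fun setT phi ->
  (forall J B, (forall i, measurable (B i)) ->
    m0 (phi @^-1` box J B) = m (box J B)) ->
  forall F : product_space E I -> \bar R,
  measurable_fun setT F -> (forall x, 0 <= F x)%E ->
  (\int[m]_x F x = \int[m0]_w F (phi w))%E.
Proof.
move=> mphi m0m F mF F0.
pose phi' : {mfun T >-> product_space E I} :=
  HB.pack phi (isMeasurableFun.Build _ _ _ _ _ mphi).
rewrite (eq_measure_integral (pushforward m0 phi')); last first.
  move=> A mA _.
  apply: (@product_space_measure_unique _ _ _ _ m (pushforward m0 phi')) => //.
    by apply: (le_lt_trans (probability_le1 m measurableT)); rewrite ltry.
  by move=> J B mB; exact: (esym (m0m J B mB)).
by rewrite ge0_integral_pushforward.
Qed.

End law_transfer.

Section iid_law.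
Context {dE : measure_display} {E : measurableType dE} {R : realType}.

Definition iid_law (I : choiceType) (g : set E -> \bar R)
    (m : set (product_space E I) -> \bar R) : Prop :=
  forall J B, (forall i, measurable (B i)) ->
    m (box J B) = (\prod_(i <- J) g (B i))%E.

Definition update (I : choiceType) (f : product_space E I) (i : I) (t : E) :
    product_space E I :=
  fun j => if j == i then t else f j.

Lemma measurable_update (I : choiceType) (i : I) :
  measurable_fun setT
    (fun ft : product_space E I * E => update ft.1 i ft.2).
Proof.
apply: measurable_product_space => j; rewrite /update.
case: eqP => _; first exact: measurable_snd.
exact: (measurableT_comp (measurable_coordinate j) measurable_fst).
Qed.

(** In an i.i.d. family one coordinate can be replaced by an independent copy
   of it. *)
Lemma integral_resample (I : choiceType) (g : probability E R)
    (m : probability (product_space E I) R) (i : I) :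
  iid_law g m -> forall F : product_space E I -> \bar R,
  measurable_fun setT F -> (forall x, 0 <= F x)%E ->
  (\int[m]_x F x = \int[m]_x \int[g]_t F (update x i t))%E.
Proof.
move=> gm F mF F0.
have mFu : measurable_fun setT
    (fun ft : product_space E I * E => F (update ft.1 i ft.2)).
  exact: (measurableT_comp mF (measurable_update i)).
rewrite (integral_law_eq (m0 := (m \x g)%E) (measurable_update i))//.
  by rewrite fubini_tonelli1.
move=> J B mB.
have -> : (fun ft : product_space E I * E => update ft.1 i ft.2) @^-1` box J B =
    box (J `\ i)%fset B `*` (if i \in J then B i else setT).
  apply/seteqP; split => -[f t] /=.
    move=> h; split.
      move=> j; rewrite !inE => /andP[ji /h]; rewrite /update.
      by rewrite (negbTE ji).
    by case: ifPn => // /h; rewrite /update eqxx.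
  move=> [h1 h2] j jJ; rewrite /update; case: eqP => [ji|/eqP ji].
    by move: h2; rewrite -ji jJ.
  by apply: h1; rewrite !inE ji.
rewrite [LHS]product_measure1E//; [|exact: measurable_box|by case: ifP].
rewrite (gm J B mB); apply: etrans (congr1 (fun u => (u * _)%E) (gm _ B mB)) _.
case: ifPn => iJ; first by rewrite muleC (big_fsetD1 i iJ).
rewrite [X in (_ * X)%E](_ : _ = 1%E); last exact: (probability_setT g).
by rewrite mule1 mem_fsetD1.
Qed.

Definition scons (t : E) (f : product_space E nat) : product_space E nat :=
  fun n => if n is k.+1 then f k else t.

Lemma measurable_scons :
  measurable_fun setT (fun tf : E * product_space E nat => scons tf.1 tf.2).
Proof.
apply: measurable_product_space => -[|k] /=; first exact: measurable_fst.
exact: (measurableT_comp (measurable_coordinate k) measurable_snd).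
Qed.

(** An i.i.d. sequence is its first term followed by an independent copy of the
   whole sequence. For sums of the terms this is the Markov property at time 1. *)
Lemma integral_scons (g : probability E R)
    (m : probability (product_space E nat) R) :
  iid_law g m -> forall F : product_space E nat -> \bar R,
  measurable_fun setT F -> (forall x, 0 <= F x)%E ->
  (\int[m]_x F x = \int[g]_t \int[m]_x F (scons t x))%E.
Proof.
move=> gm F mF F0.
have mFu : measurable_fun setT
    (fun tf : E * product_space E nat => F (scons tf.1 tf.2)).
  exact: (measurableT_comp mF measurable_scons).
rewrite (integral_law_eq (m0 := (g \x m)%E) measurable_scons)//.
  by rewrite fubini_tonelli1.
move=> J B mB.
pose K := [fset k.-1 | k in J & k != 0%N]%fset.
have inK k : (k \in K) = (k.+1 \in J).
  apply/imfsetP/idP => /=.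
    by move=> [[|j]] /=; rewrite !inE ?andbF//= => /andP[jJ _] ->.
  by move=> kJ; exists k.+1 => //; rewrite !inE kJ.
have -> : (fun tf : E * product_space E nat => scons tf.1 tf.2) @^-1` box J B =
    (if 0%N \in J then B 0%N else setT) `*` box K (fun k => B k.+1).
  apply/seteqP; split => -[t f] /=.
    move=> h; split; first by case: ifPn => // /h.
    by move=> k; rewrite inK => /h.
  move=> [h1 h2] [|k] kJ /=; first by move: h1; rewrite kJ.
  by apply: h2; rewrite inK.
rewrite [LHS]product_measure1E//; [|by case: ifP|exact: measurable_box].
rewrite (gm J B mB).
apply: etrans (congr1 (fun u => (_ * u)%E) (gm K _ (fun k => mB k.+1))) _.
have eqK : (\prod_(i <- K) g (B i.+1) =
    \prod_(i <- (J `\ 0%N)%fset) g (B i))%E.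
  have -> : (J `\ 0%N)%fset = [fset k.+1 | k in K]%fset.
    apply/fsetP => -[|k]; rewrite !inE /=.
      by symmetry; apply/imfsetP => -[].
    rewrite -inK; apply/idP/imfsetP => [kK|[j /= jK [->]]//].
    by exists k.
  by rewrite [RHS]big_imfset//= => i j _ _ [].
case: ifPn => iJ.
  by rewrite eqK (big_fsetD1 0%N iJ).
rewrite [X in (X * _)%E](_ : _ = 1%E); last exact: (probability_setT g).
by rewrite mul1e eqK mem_fsetD1.
Qed.

Lemma integral_reindex (I : choiceType) (g : set E -> \bar R)
    (m : probability (product_space E I) R) (s r : I -> I) :
  cancel s r -> cancel r s ->
  iid_law g m -> forall F : product_space E I -> \bar R,
  measurable_fun setT F -> (forall x, 0 <= F x)%E ->
  (\int[m]_x F x = \int[m]_x F (fun i => x (s i)))%E.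
Proof.
move=> sr rs gm F mF F0.
have mphi : measurable_fun setT
    (fun (x : product_space E I) => (fun i => x (s i)) : product_space E I).
  by apply: measurable_product_space => i; exact: measurable_coordinate.
rewrite (integral_law_eq (m0 := m) mphi)//.
move=> J B mB.
have -> : (fun (x : product_space E I) => (fun i => x (s i)) : product_space E I)
    @^-1` box J B = box [fset s i | i in J]%fset (fun i => B (r i)).
  apply/seteqP; split => x /=.
    by move=> h i /imfsetP[j /= jJ ->]; rewrite sr; exact: h.
  move=> h i iJ; rewrite -[in B i](sr i); apply: h.
  by apply/imfsetP; exists i.
rewrite (gm J B mB); apply: etrans (gm _ _ (fun i => mB (r i))) _.
rewrite big_imfset/=; last by move=> i j _ _ /(congr1 r); rewrite !sr.
by apply: eq_bigr => i _; rewrite sr.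
Qed.

End iid_law.

(** * The standard Gaussian law *)

Section gaussian.
Context {R : realType}.
Local Notation lam := (@lebesgue_measure R).
Local Notation gauss := (@normal_prob R 0 1).
Local Notation pdf := (@normal_pdf R 0 1).

Lemma measurable_EFin_normal_pdf :
  measurable_fun setT (fun x : R => (pdf x)%:E).
Proof. by apply/measurable_EFinP; exact: measurable_normal_pdf. Qed.

Lemma measurable_expR_affine (a b : R) :
  measurable_fun setT (fun t : R => expR (- (a * t) + b)).
Proof.
apply: (measurableT_comp (@measurable_expR R)).
apply: measurable_funD => //.
by apply: measurable_funN; exact: measurable_funM.
Qed.

(** The density of the Gaussian law is also its Radon-Nikodym derivative, up to
   a negligible set; the change of measure formula is known for the latter. *)
Lemma integral_normal_prob (f : R -> \bar R) :
  measurable_fun setT f -> (forall x, 0 <= f x)%E ->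
  (\int[gauss]_x f x = \int[lam]_x (f x * (pdf x)%:E))%E.
Proof.
move=> mf f0.
have dom := @normal_prob_dominates R 0 1.
rewrite -(Radon_Nikodym_SigmaFinite.change_of_variables dom)//.
set g := Radon_Nikodym_SigmaFinite.f _ _.
have ig : lam.-integrable setT g by exact: Radon_Nikodym_SigmaFinite.f_integrable.
apply: ae_eq_integral => //.
- by apply: emeasurable_funM => //; exact: (measurable_int lam).
- by apply: emeasurable_funM => //; exact: measurable_EFin_normal_pdf.
- apply: ae_eqe_mul2l; apply: integral_ae_eq => //.
    exact: measurable_EFin_normal_pdf.
  by move=> E _ mE; rewrite -Radon_Nikodym_SigmaFinite.f_integral.
Qed.

Lemma integral_lebesgue_shift (a : R) (f : R -> \bar R) :
  measurable_fun setT f -> (forall x, 0 <= f x)%E ->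
  (\int[lam]_x f (x + a)%R = \int[lam]_x f x)%E.
Proof.
move=> mf f0.
have ma : measurable_fun setT (fun x : measurableTypeR R => x + a : measurableTypeR R).
  exact: measurable_funD.
pose phi : {mfun measurableTypeR R >-> measurableTypeR R} :=
  HB.pack (fun x : R => x + a) (isMeasurableFun.Build _ _ _ _ _ ma).
rewrite [RHS](eq_measure_integral (pushforward lam phi)).
  by rewrite ge0_integral_pushforward.
move=> A mA _; apply: lebesgue_measure_unique => //= _ [[u v]] _ <-.
rewrite /pushforward /=.
have -> : (fun x : R => x + a) @^-1` `]u, v] = `]u - a, v - a]%classic.
  by apply/seteqP; split => x /=; rewrite !in_itv/= ltrBlDr lerBrDr.
rewrite !lebesgue_measure_itv/= !lte_fin ltrD2r.
by case: ifP => // _; rewrite -!EFinD; congr (_%:E); ring.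
Qed.

Lemma integral_lebesgue_opp (f : R -> \bar R) :
  measurable_fun setT f -> (forall x, 0 <= f x)%E ->
  (\int[lam]_x f (- x)%R = \int[lam]_x f x)%E.
Proof.
move=> mf f0.
rewrite [RHS](eq_measure_integral
    (pushforward lam (-%R : _ -> measurableTypeR R))).
  by rewrite ge0_integral_pushforward.
by move=> A mA _; exact/esym/lebesgue_measureN.
Qed.

Lemma normal_pdf01 (x : R) : pdf x = normal_peak 1 * expR (- (x ^+ 2 / 2)).
Proof.
rewrite normal_pdfE ?oner_neq0// /normal_fun subr0 expr1n.
by rewrite mulNr.
Qed.

(** Translating the Gaussian density by a multiplies it by an exponential. *)
Lemma normal_prob_cameron_martin (a : R) (h : R -> \bar R) :
  measurable_fun setT h -> (forall x, 0 <= h x)%E ->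
  (\int[gauss]_t h (t - a)%R =
   \int[gauss]_t (h t * (expR (- (a * t) - a ^+ 2 / 2))%:E))%E.
Proof.
move=> mh h0.
have mha : measurable_fun setT (fun t : R => h (t - a)).
  by apply: (measurableT_comp mh); exact: measurable_funB.
rewrite integral_normal_prob// -(integral_lebesgue_shift a); last 2 first.
- by apply: emeasurable_funM => //; exact: measurable_EFin_normal_pdf.
- by move=> x; rewrite mule_ge0// lee_fin normal_pdf_ge0.
have me : measurable_fun setT (fun t : R => expR (- (a * t) - a ^+ 2 / 2)).
  exact: measurable_expR_affine.
rewrite integral_normal_prob; last 2 first.
- by apply: emeasurable_funM => //; exact/measurable_EFinP.
- by move=> x; rewrite mule_ge0 ?lee_fin ?expR_ge0.
apply: eq_integral => x _; rewrite addrK -muleA; congr (_ * _)%E.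
rewrite -EFinM !normal_pdf01 mulrCA -expRD; congr ((_ * expR _)%:E).
by field.
Qed.

(** The Cameron-Martin formula for the constant function 1. *)
Lemma normal_prob_mgf (a : R) :
  (\int[gauss]_t (expR (a * t))%:E = (expR (a ^+ 2 / 2))%:E)%E.
Proof.
have := @normal_prob_cameron_martin (- a) (fun=> 1%E).
rewrite integral_prob_cst => /(_ _ _)/esym h.
have -> : (\int[gauss]_t (expR (a * t))%:E =
  \int[gauss]_t ((expR (a ^+ 2 / 2))%:E *
     (1 * (expR (- (- a * t) - (- a) ^+ 2 / 2))%:E)))%E.
  apply: eq_integral => t _; rewrite mul1e -EFinM -expRD; congr ((expR _)%:E).
  by field.
have me : measurable_fun setT
    (fun t : R => (1 * (expR (- (- a * t) - (- a) ^+ 2 / 2))%:E)%E).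
  under eq_fun do rewrite mul1e.
  by apply/measurable_EFinP; exact: measurable_expR_affine.
rewrite ge0_integralZl//.
by rewrite h ?mule1.
Qed.

Lemma normal_prob_sym (f : R -> \bar R) :
  measurable_fun setT f -> (forall x, 0 <= f x)%E ->
  (\int[gauss]_t f (- t)%R = \int[gauss]_t f t)%E.
Proof.
move=> mf f0.
have mfN : measurable_fun setT (fun t : R => f (- t)).
  exact: (measurableT_comp mf).
rewrite !integral_normal_prob// -[RHS]integral_lebesgue_opp; last 2 first.
- by apply: emeasurable_funM => //; exact: measurable_EFin_normal_pdf.
- by move=> x; rewrite mule_ge0// lee_fin normal_pdf_ge0.
by apply: eq_integral => t _; rewrite !normal_pdf01 sqrrN.
Qed.

(** The density ratio exp(- t / A - 1 / (2 A^2)) is at most e for t >= - A. For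
   t < - A it is at most exp(- t) <= exp(- A - 2 t), whose integral is
   exp(2 - A). *)
Lemma normal_prob_shift_le (A : R) (h : R -> R) :
  1 <= A -> measurable_fun setT h -> (forall t, 0 <= h t <= 1) ->
  (\int[gauss]_t (h (t - A^-1))%:E <=
   (expR 1)%:E * \int[gauss]_t (h t)%:E + (expR (2 - A))%:E)%E.
Proof.
move=> A1 mh h01; have A0 : 0 < A by exact: lt_le_trans A1.
have h0 t : 0 <= h t by have /andP[] := h01 t.
rewrite (@normal_prob_cameron_martin A^-1 (fun t => (h t)%:E))//;
  last exact/measurable_EFinP.
have me (c : R) : measurable_fun setT (fun t : R => (expR (c * t))%:E).
  apply/measurable_EFinP; apply: (measurableT_comp (@measurable_expR R)).
  exact: measurable_funM.
have mh' : measurable_fun setT (fun t => (h t)%:E) by exact/measurable_EFinP.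
apply: (@le_trans _ _ (\int[gauss]_t ((expR 1)%:E * (h t)%:E +
    (expR (- A))%:E * (expR (- 2 * t))%:E))%E).
  apply: ge0_le_integral => //.
  - by move=> t _; rewrite mule_ge0 ?lee_fin ?expR_ge0.
  - apply: emeasurable_funM => //; apply/measurable_EFinP.
    exact: measurable_expR_affine.
  - by apply: emeasurable_funD; apply: emeasurable_funM => //; exact: me.
  - move=> t _; rewrite -!EFinM -EFinD lee_fin -expRD.
    have q0 : 0 <= A^-1 ^+ 2 / 2 by rewrite divr_ge0// sqr_ge0.
    have Ai : A^-1 <= 1 by rewrite invf_le1.
    have Ai0 : 0 < A^-1 by rewrite invr_gt0.
    have /andP[ht0 ht1] := h01 t.
    have [tA|tA] := leP (- A) t.
      apply: (@le_trans _ _ (expR 1 * h t)); last by rewrite lerDl expR_ge0.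
      rewrite mulrC ler_wpM2r// ler_expR.
      have : A^-1 * (- A) <= A^-1 * t by rewrite ler_wpM2l// ltW.
      by rewrite mulrN mulVf ?gt_eqF//; lra.
    apply: (@le_trans _ _ (expR (- A + - 2 * t))); last first.
      by rewrite lerDr mulr_ge0// expR_ge0.
    apply: (@le_trans _ _ (1 * expR (- A + -2 * t))); last by rewrite mul1r.
    apply: ler_pM; rewrite ?expR_ge0 //.
    rewrite ler_expR.
    have : A^-1 * (- t) <= 1 * (- t) by rewrite ler_wpM2r//; lra.
    by rewrite mul1r mulrN; lra.
have m1 : measurable_fun setT (fun t => ((expR 1)%:E * (h t)%:E)%E).
  exact: emeasurable_funM.
have m2 : measurable_fun setT
    (fun t : R => ((expR (- A))%:E * (expR (- 2 * t))%:E)%E).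
  by apply: emeasurable_funM => //; exact: me.
rewrite ge0_integralD//; [|by move=> t _; rewrite mule_ge0 ?lee_fin ?expR_ge0..].
rewrite !ge0_integralZl//; [|exact: me|by move=> t _; rewrite lee_fin h0].
rewrite normal_prob_mgf -EFinM -expRD.
by rewrite leeD2l// lee_fin ler_expR; lra.
Qed.

End gaussian.

(** * Paths, running maxima and the environment seen from the walker *)

Section paths.
Context {R : realType} {d : nat}.
Implicit Types (x : lattice d -> R) (y : nat -> lattice d).

Definition position y n : lattice d := \sum_(i < n) y i.

Definition scenery_sum x y n : R := \sum_(i < n) x (position y i.+1).

Definition translate (a : lattice d) x : lattice d -> R := fun b => x (a + b).

Definition stail y : nat -> lattice d := fun n => y n.+1.

(** The maximum of the partial sums at times 0, ..., n, see runmax_le. The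
   recursion removes the first step and looks at the scenery from the site that
   it reaches, which is the form in which stationarity applies. *)
Fixpoint runmax n x y : R :=
  if n is m.+1 then
    Num.max 0 (x (y 0%N) + runmax m (translate (y 0%N) x) (stail y))
  else 0.

(** The maximum of the partial sums at times 1, ..., m + 1, see postmax_le. *)
Definition postmax m x y : R :=
  x (y 0%N) + runmax m (translate (y 0%N) x) (stail y).

Lemma position0 y : position y 0 = 0.
Proof. by rewrite /position big_ord0. Qed.

Lemma positionS y n : position y n.+1 = y 0%N + position (stail y) n.
Proof. by rewrite /position big_ord_recl. Qed.

Lemma position1 y : position y 1 = y 0%N.
Proof. by rewrite positionS position0 addr0. Qed.

Lemma scenery_sum0 x y : scenery_sum x y 0 = 0.
Proof. by rewrite /scenery_sum big_ord0. Qed.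

Lemma scenery_sumS x y n : scenery_sum x y n.+1 =
  x (y 0%N) + scenery_sum (translate (y 0%N) x) (stail y) n.
Proof.
rewrite /scenery_sum big_ord_recl position1; congr (_ + _).
by apply: eq_bigr => i _; rewrite /translate positionS.
Qed.

Lemma runmax_le n x y c :
  runmax n x y <= c <-> forall k, (k <= n)%N -> scenery_sum x y k <= c.
Proof.
elim: n x y c => [|n IH] x y c /=.
  split=> [c0 [|//] _|/(_ 0%N isT)]; first by rewrite scenery_sum0.
  by rewrite scenery_sum0.
rewrite ge_max -lerBrDl; split.
  move=> /andP[c0 /IH h] [|k] kn; first by rewrite scenery_sum0.
  by rewrite scenery_sumS -lerBrDl; apply: h.
move=> h; apply/andP; split.
  by have := h 0%N isT; rewrite scenery_sum0.
by apply/IH => k kn; rewrite lerBrDl -scenery_sumS; exact: h.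
Qed.

Lemma postmax_le m x y c :
  postmax m x y <= c <-> forall k, (k <= m)%N -> scenery_sum x y k.+1 <= c.
Proof.
rewrite /postmax -lerBrDl.
split=> [/runmax_le h k km|h]; first by rewrite scenery_sumS -lerBrDl h.
by apply/runmax_le => k km; rewrite lerBrDl -scenery_sumS h.
Qed.

Lemma runmax_ge0 n x y : 0 <= runmax n x y.
Proof.
by have /runmax_le/(_ 0%N isT) := lexx (runmax n x y); rewrite scenery_sum0.
Qed.

Lemma scenery_sum_le_runmax n x y : scenery_sum x y n <= runmax n x y.
Proof. by have /runmax_le := lexx (runmax n x y); apply. Qed.

Lemma le_postmax m m' x y : (m <= m')%N -> postmax m x y <= postmax m' x y.
Proof.
move=> mm'; apply/postmax_le => k km.
have /postmax_le := lexx (postmax m' x y); apply; exact: leq_trans mm'.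
Qed.

Lemma postmax_ge m x y : x (y 0%N) <= postmax m x y.
Proof. by rewrite lerDl runmax_ge0. Qed.

(** The first visited site is counted in every partial sum, so lowering the
   scenery there lowers all of them by at least the same amount. *)
Lemma postmax_shift m x y (t e : R) : 0 <= e ->
  postmax m (fun b => if b == y 0%N then t - e else x b) y <=
  postmax m (fun b => if b == y 0%N then t else x b) y - e.
Proof.
move=> e0; set x' := fun b => if b == y 0%N then t else x b.
apply/postmax_le => k km.
apply: (@le_trans _ _ (scenery_sum x' y k.+1 - e)); last first.
  rewrite lerD2r; have /postmax_le := lexx (postmax m x' y); exact.
rewrite /scenery_sum !big_ord_recl position1 /x' eqxx [leRHS]addrAC.
by apply: lerD => //; apply: ler_sum => i _; case: eqP => _; rewrite ?lerBlDr ?lerDl.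
Qed.

End paths.

Section skew_product.
Context {R : realType} {d : nat}.
Notation scenery := (product_space (measurableTypeR R) (lattice d)).
Notation steps := (product_space (lattice d) nat).

Lemma measurable_position n :
  measurable_fun setT (fun y : steps => position y n).
Proof.
elim: n => [|n IH].
  by rewrite [X in measurable_fun _ X](_ : _ = cst 0)//;
    apply/funext => y; exact: position0.
rewrite [X in measurable_fun _ X](_ : _ = fun y => position y n + y n).
  by apply: measurable_latticeD => //; exact: measurable_coordinate.
by apply/funext => y; rewrite /position big_ord_recr.
Qed.

Lemma measurable_scenery_at (f : scenery * steps -> lattice d) :
  measurable_fun setT f -> measurable_fun setT (fun w : scenery * steps => w.1 (f w) : R).
Proof.
move=> mf.
apply: (measurable_select (h := fun c (w : scenery * steps) => w.1 c)) => // c.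
exact: (measurableT_comp (measurable_coordinate c) measurable_fst).
Qed.

(** One step of the walk, with the scenery seen from the new position. *)
Definition skew (w : scenery * steps) : scenery * steps :=
  (translate (w.2 0%N) w.1, stail w.2).

Lemma measurable_stail : measurable_fun setT (stail : steps -> steps).
Proof.
by apply: measurable_product_space => i; exact: measurable_coordinate.
Qed.

Lemma measurable_skew : measurable_fun setT skew.
Proof.
apply: measurable_fun_pair.
  apply: measurable_product_space => b; rewrite /translate/=.
  apply: measurable_scenery_at; apply: measurable_latticeD => //.
  exact: (measurableT_comp (measurable_coordinate 0%N) measurable_snd).
exact: (measurableT_comp measurable_stail measurable_snd).
Qed.

Lemma measurable_first_scenery :
  measurable_fun setT (fun w : scenery * steps => w.1 (w.2 0%N) : R).
Proof.
apply: measurable_scenery_at.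
exact: (measurableT_comp (measurable_coordinate 0%N) measurable_snd).
Qed.

Lemma measurable_runmax n :
  measurable_fun setT (fun w : scenery * steps => runmax n w.1 w.2 : R).
Proof.
elim: n => [|n IH] //=.
apply: measurable_maxr => //; apply: measurable_funD.
  exact: measurable_first_scenery.
exact: (measurableT_comp IH measurable_skew).
Qed.

Lemma measurable_postmax n :
  measurable_fun setT (fun w : scenery * steps => postmax n w.1 w.2 : R).
Proof.
apply: measurable_funD; first exact: measurable_first_scenery.
exact: (measurableT_comp (measurable_runmax n) measurable_skew).
Qed.

Lemma measurable_scenery_sum n :
  measurable_fun setT (fun w : scenery * steps => scenery_sum w.1 w.2 n : R).
Proof.
apply: measurable_sum => i; apply: measurable_scenery_at.
exact: (measurableT_comp (measurable_position i.+1) measurable_snd).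
Qed.

Context (g : probability (measurableTypeR R) R) (r : probability (lattice d) R)
  (mu : probability scenery R) (nu : probability steps R).
Hypotheses (gmu : iid_law g mu) (rnu : iid_law r nu).

Lemma integral_stail (F : steps -> \bar R) :
  measurable_fun setT F -> (forall y, 0 <= F y)%E ->
  (\int[nu]_y F (stail y) = \int[nu]_y F y)%E.
Proof.
move=> mF F0.
rewrite (integral_scons rnu)//; last exact: (measurableT_comp mF measurable_stail).
rewrite -[RHS](integral_prob_cst r).
by apply: eq_integral => t _; apply: eq_integral.
Qed.

(** The scenery seen from the walker is stationary. *)
Lemma integral_skew (F : scenery * steps -> \bar R) :
  measurable_fun setT F -> (forall w, 0 <= F w)%E ->
  (\int[mu \x nu]_w F (skew w) = \int[mu \x nu]_w F w)%E.
Proof.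
move=> mF F0.
have mFs : measurable_fun setT (F \o skew).
  exact: (measurableT_comp mF measurable_skew).
have mFt : measurable_fun setT (fun w : scenery * steps => F (w.1, stail w.2)).
  apply: (measurableT_comp mF); apply: measurable_fun_pair => //.
  exact: (measurableT_comp measurable_stail measurable_snd).
rewrite fubini_tonelli2//.
transitivity (\int[nu]_y \int[mu]_x F (x, stail y))%E.
  apply: eq_integral => y _; rewrite /fubini_G/= /skew/=.
  rewrite [RHS](integral_reindex (s := fun b => y 0%N + b)
    (r := fun b => - y 0%N + b) _ _ gmu) //.
  - by move=> b; rewrite addKr.
  - by move=> b; rewrite addNKr.
  - by apply: (measurableT_comp mF); exact: measurable_pair2.
have := fubini_tonelli2 (m1 := mu) (m2 := nu) _ mFt (fun w => F0 _).
rewrite fubini_tonelli1// => <-.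
rewrite (fubini_tonelli1 _ mF F0); apply: eq_integral => x _.
apply: integral_stail => //.
by apply: (measurableT_comp mF); exact: measurable_pair1.
Qed.

End skew_product.

(** * Mean maximum, mean overshoot and persistence probability *)

Lemma maxr0_split (R : realDomainType) (f v : R) :
  Num.max 0 (- f) + Num.max 0 (f + v) =
  Num.max 0 f + v + Num.max 0 (- (f + v)).
Proof. by rewrite !maxEle; repeat case: ifPn; rewrite -?ltNge; lra. Qed.

Section persistence_recursion.
Context {R : realType} {d : nat}.
Notation scenery := (product_space (measurableTypeR R) (lattice d)).
Notation steps := (product_space (lattice d) nat).
Context (r : probability (lattice d) R)
  (mu : probability scenery R) (nu : probability steps R).
Hypotheses (gmu : iid_law (normal_prob 0 1) mu) (rnu : iid_law r nu).
Local Notation gauss := (@normal_prob R 0 1).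
Local Notation Pr := (mu \x nu)%E.
Local Notation first w := (w.1 (w.2 0%N)).

Definition mean_runmax n : \bar R :=
  (\int[Pr]_(w in setT) (runmax n (w.1 : scenery) w.2)%:E)%E.

Definition mean_overshoot m : \bar R :=
  (\int[Pr]_(w in setT) (Num.max 0 (- postmax m (w.1 : scenery) w.2))%:E)%E.

Definition persistence m : \bar R :=
  Pr [set w | postmax m (w.1 : scenery) w.2 <= 0].

Lemma integral_coordinate (a : lattice d) (f : R -> \bar R) :
  measurable_fun setT f -> (forall t, 0 <= f t)%E ->
  (\int[mu]_x f (x a) = \int[gauss]_t f t)%E.
Proof.
move=> mf f0.
rewrite (integral_resample a gmu) //; last first.
  exact: (measurableT_comp mf (measurable_coordinate a)).
rewrite -[RHS](integral_prob_cst mu); apply: eq_integral => x _.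
by apply: eq_integral => t _; rewrite /update eqxx.
Qed.

Lemma integral_first (f : R -> \bar R) :
  measurable_fun setT f -> (forall t, 0 <= f t)%E ->
  (\int[Pr]_(w in setT) f (first w) = \int[gauss]_t f t)%E.
Proof.
move=> mf f0.
rewrite fubini_tonelli2//; last exact: (measurableT_comp mf measurable_first_scenery).
rewrite -[RHS](integral_prob_cst nu); apply: eq_integral => y _.
exact: integral_coordinate.
Qed.

Lemma measurable_max0 dT (T : measurableType dT) (f : T -> R) :
  measurable_fun setT f ->
  measurable_fun setT (fun w => (Num.max 0 (f w))%:E).
Proof. by move=> mf; apply/measurable_EFinP; exact: measurable_maxr. Qed.

(** With f the scenery at the first site and M the maximum seen from there, the
   maximum at time m + 1 is max(0, f + M), which is f + M + max(0, - (f + M)).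
   Integrate: f is centred, and M has the law of the maximum at time m by
   stationarity. To integrate nonnegative functions only, f is moved to both
   sides as the difference of its positive and negative parts. *)
Lemma mean_runmaxS m :
  (mean_runmax m.+1 = mean_runmax m + mean_overshoot m)%E.
Proof.
have mfst := @measurable_first_scenery R d.
have mfstN : measurable_fun setT (fun w : scenery * steps => - first w : R).
  exact: measurable_funN.
have mpost := @measurable_postmax R d m.
have mpostN : measurable_fun setT
    (fun w : scenery * steps => - postmax m w.1 w.2 : R).
  exact: measurable_funN.
have m0 (t : R) : (0 <= (Num.max 0 t)%:E)%E by rewrite lee_fin le_max lexx.
have mM : measurable_fun setT
    (fun w : scenery * steps => (runmax m w.1 w.2)%:E).
  by apply/measurable_EFinP; exact: measurable_runmax.
have mMs : measurable_fun setT
    (fun w : scenery * steps => (runmax m (skew w).1 (skew w).2)%:E).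
  exact: (measurableT_comp mM measurable_skew).
have M0 (w : scenery * steps) : (0 <= (runmax m w.1 w.2)%:E)%E.
  by rewrite lee_fin runmax_ge0.
pose c := (\int[gauss]_t (Num.max 0 t)%:E)%E.
have cE : (\int[Pr]_(w in setT) (Num.max 0 (first w))%:E = c)%E.
  by rewrite (integral_first (f := fun t => (Num.max 0 t)%:E))//;
    exact: measurable_max0.
have cNE : (\int[Pr]_(w in setT) (Num.max 0 (- first w))%:E = c)%E.
  rewrite (integral_first (f := fun t => (Num.max 0 (- t))%:E))//; last first.
    by apply: measurable_max0; exact: measurable_funN.
  by rewrite (normal_prob_sym (f := fun t => (Num.max 0 t)%:E))//;
    exact: measurable_max0.
have cfin : c \is a fin_num.
  rewrite ge0_fin_numE; last exact: integral_ge0.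
  apply: (@le_lt_trans _ _ (\int[gauss]_t (expR (1 * t))%:E)%E); last first.
    by rewrite normal_prob_mgf ltry.
  apply: ge0_le_integral => //.
  - exact: measurable_max0.
  - apply/measurable_EFinP; apply: (measurableT_comp (@measurable_expR R)).
    exact: measurable_funM.
  - move=> t _; rewrite lee_fin ge_max expR_ge0/= mul1r.
    by apply: le_trans (expR_ge1Dx t); rewrite lerDr.
suff h : (c + mean_runmax m.+1 = c + (mean_runmax m + mean_overshoot m))%E.
  by rewrite -[LHS](addeK _ cfin) (addeC _ c) h (addeC c) addeK.
have m1 : measurable_fun setT
    (fun w : scenery * steps => (Num.max 0 (first w))%:E : \bar R).
  exact: measurable_max0.
have m2 : measurable_fun setT
    (fun w : scenery * steps => (Num.max 0 (- first w))%:E : \bar R).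
  exact: measurable_max0.
have m3 : measurable_fun setT
    (fun w : scenery * steps => (Num.max 0 (postmax m w.1 w.2))%:E : \bar R).
  exact: measurable_max0.
have m4 : measurable_fun setT
    (fun w : scenery * steps => (Num.max 0 (- postmax m w.1 w.2))%:E : \bar R).
  exact: measurable_max0.
have e1 : (\int[Pr]_(w in setT) ((Num.max 0 (- first w))%:E +
    (Num.max 0 (postmax m w.1 w.2))%:E) = c + mean_runmax m.+1)%E.
  by rewrite ge0_integralD// cNE.
have e2 : (\int[Pr]_(w in setT) ((Num.max 0 (first w))%:E +
    (runmax m (skew w).1 (skew w).2)%:E) = c + mean_runmax m)%E.
  rewrite ge0_integralD//.
  by rewrite cE (integral_skew gmu rnu (F := fun w => (runmax m w.1 w.2)%:E)).
rewrite -e1 addeA -e2 -ge0_integralD//.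
- by apply: eq_integral => w _; rewrite -!EFinD maxr0_split.
- by move=> w _; apply: adde_ge0 => //; exact: (M0 (skew w)).
- exact: emeasurable_funD.
Qed.

Lemma mean_overshoot_le m m' : (m <= m')%N ->
  (mean_overshoot m' <= mean_overshoot m)%E.
Proof.
move=> mm'; apply: ge0_le_integral => //.
- by move=> w _; rewrite lee_fin le_max lexx.
- by apply: measurable_max0; apply: measurable_funN; exact: measurable_postmax.
- by apply: measurable_max0; apply: measurable_funN; exact: measurable_postmax.
- move=> w _; rewrite lee_fin ge_max le_max lexx/= le_max lerN2.
  by rewrite le_postmax// orbT.
Qed.

Lemma measurable_postmax_le m (c : R) :
  measurable [set w : scenery * steps | postmax m w.1 w.2 <= c].
Proof.
rewrite -[X in measurable X]setTI.
rewrite (_ : [set w | _] = (fun w : scenery * steps => postmax m w.1 w.2)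
   @^-1` `]-oo, c]%classic).
  exact: measurable_postmax.
by apply/seteqP; split => w /=; rewrite in_itv.
Qed.

(** On the event that all sums are nonpositive, the overshoot is at most the
   negative part of the first scenery value. For u the opposite of that value,
   u <= A + exp(2 u - A), and the last term has mean exp(2 - A). *)
Lemma mean_overshoot_le_persistence m (A : R) : 0 <= A ->
  (mean_overshoot m <= A%:E * persistence m + (expR (2 - A))%:E)%E.
Proof.
move=> A0.
have me : measurable_fun setT (fun t : R => (expR (- 2 * t))%:E).
  apply/measurable_EFinP; apply: (measurableT_comp (@measurable_expR R)).
  exact: measurable_funM.
have mef : measurable_fun setT
    (fun w : scenery * steps => (expR (- 2 * first w))%:E).
  exact: (measurableT_comp me measurable_first_scenery).
have mL := measurable_postmax_le m 0.
have -> : ((expR (2 - A))%:E = (expR (- A))%:E *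
    \int[Pr]_(w in setT) (expR (- 2 * first w))%:E)%E.
  rewrite (integral_first (f := fun t => (expR (- 2 * t))%:E))//.
  by rewrite normal_prob_mgf -EFinM -expRD; congr ((expR _)%:E); field.
have -> : (persistence m = \int[Pr]_(w in setT)
    (\1_[set w : scenery * steps | postmax m w.1 w.2 <= 0] w)%:E)%E.
  by rewrite integral_indic// setIT.
have m1 : measurable_fun setT (fun w : scenery * steps =>
    (\1_[set w : scenery * steps | postmax m w.1 w.2 <= 0] w)%:E : \bar R).
  by apply/measurable_EFinP; exact: measurable_indic.
rewrite -ge0_integralZl//.
rewrite -ge0_integralZl//.
have n1 : measurable_fun setT (fun w : scenery * steps => (A%:E *
    (\1_[set w : scenery * steps | postmax m w.1 w.2 <= 0] w)%:E)%E).
  exact: emeasurable_funM.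
have n2 : measurable_fun setT (fun w : scenery * steps =>
    ((expR (- A))%:E * (expR (- 2 * first w))%:E)%E).
  exact: emeasurable_funM.
rewrite -ge0_integralD//; first last.
- by move=> w _; rewrite mule_ge0// lee_fin.
- apply: ge0_le_integral => //.
  + by move=> w _; rewrite lee_fin le_max lexx.
  + by apply: measurable_max0; apply: measurable_funN; exact: measurable_postmax.
  + exact: emeasurable_funD.
  + move=> w _; rewrite -!EFinM -EFinD lee_fin indicE.
    have [L0|L0] := leP (postmax m w.1 w.2) 0.
      rewrite mem_set//= mulr1.
      have := postmax_ge m (w.1 : scenery) w.2; set f := first w => fL.
      rewrite -expRD ge_max; apply/andP; split.
        by rewrite addr_ge0// expR_ge0.
      apply: (@le_trans _ _ (- f)); first by rewrite lerN2.
      have [fA|fA] := leP (- f) A.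
        by apply: (le_trans fA); rewrite lerDl expR_ge0.
      by have := expR_ge1Dx (- A + - 2 * f); lra.
    rewrite memNset ?mulr0 ?add0r//=; last by apply/negP; rewrite -ltNge.
    rewrite max_l; first by rewrite mulr_ge0// expR_ge0.
    by rewrite oppr_le0 ltW.
Qed.


Lemma measurable_postmax_section m (y : steps) (c : R) :
  measurable [set x : scenery | postmax m x y <= c].
Proof.
have := measurable_ysection y (measurable_postmax_le m c).
by rewrite /ysection /=; congr measurable; apply/seteqP; split => x /=;
  rewrite in_setE.
Qed.

(** Resample the scenery at the first site only. Lowering that value by 1 / A
   lowers all the sums by at least 1 / A, and costs a factor e in probability
   up to a Gaussian tail. *)
Lemma postmax_section_le m (y : steps) (A : R) : 1 <= A ->
  (mu [set x : scenery | (postmax m x y <= 0)%R] <=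
   (expR 1)%:E * mu [set x : scenery | (postmax m x y <= - A^-1)%R] +
   (expR (2 - A))%:E)%E.
Proof.
move=> A1; set s := y 0%N.
set U := [set x : scenery | _]; set V := [set x : scenery | _].
have mU : measurable U by exact: measurable_postmax_section.
have mV : measurable V by exact: measurable_postmax_section.
have mup (x : scenery) : measurable_fun setT
    (fun t : measurableTypeR R => update x s t).
  have h := measurable_update (E := measurableTypeR R) s.
  exact: (measurableT_comp h (@measurable_pair1 _ _ _ _ x)).
have mi (W : set scenery) : measurable W ->
    measurable_fun setT (fun x : scenery => (\1_W x)%:E : \bar R).
  by move=> mW; apply/measurable_EFinP; exact: measurable_indic.
have resample W : measurable W ->
    (mu W = \int[mu]_x \int[gauss]_t (\1_W (update x s t))%:E)%E.
  move=> mW; rewrite -(integral_resample s gmu (mi W mW)).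
    by rewrite integral_indic// setIT.
  by move=> x; rewrite lee_fin.
have mI W : measurable W -> measurable_fun setT
    (fun x : scenery => \int[gauss]_t (\1_W (update x s t))%:E)%E.
  move=> mW.
  have mf : measurable_fun setT (fun xt : scenery * measurableTypeR R =>
      (\1_W (update xt.1 s xt.2))%:E : \bar R).
    exact: (measurableT_comp (mi W mW) (measurable_update s)).
  have := @measurable_fun_fubini_tonelli_F _ _ _ _ _ gauss _ mf.
  by apply => xt; rewrite lee_fin.
rewrite (resample U mU) (resample V mV).
have I0 W x : (0 <= \int[gauss]_t (\1_W (update x s t))%:E)%E.
  by apply: integral_ge0 => t _; rewrite lee_fin.
have mR : measurable_fun setT (fun x : scenery =>
    ((expR 1)%:E * \int[gauss]_t (\1_V (update x s t))%:E)%E).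
  by apply: emeasurable_funM => //; exact: mI.
rewrite -ge0_integralZl//; last exact: mI.
rewrite -[X in (_ <= _ + X)%E](integral_prob_cst mu).
rewrite -ge0_integralD//; last by move=> x _; rewrite mule_ge0 ?lee_fin ?expR_ge0.
apply: ge0_le_integral => //; first exact: mI.
  exact: emeasurable_funD.
move=> x _; pose h (t : R) : R := \1_V (update x s t).
have mh : measurable_fun setT h.
  by apply/measurable_EFinP; exact: (measurableT_comp (mi V mV) (mup x)).
have h01 t : 0 <= h t <= 1 by rewrite /h indicE; case: (_ \in _); rewrite !lexx ler01.
apply: le_trans (normal_prob_shift_le A1 mh h01).
apply: ge0_le_integral => //.
- exact: (measurableT_comp (mi U mU) (mup x)).
- apply: (measurableT_comp (f := fun t => (h t)%:E)); first exact/measurable_EFinP.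
  exact: measurable_funB.
- move=> t _; rewrite lee_fin /h !indicE.
  have [tU|_] := boolP (_ \in U); last by case: (_ \in V).
  rewrite mem_set//=; rewrite inE /= in tU.
  have A0 : 0 <= A^-1 by rewrite invr_ge0; apply: le_trans A1.
  have : postmax m (update x s (t - A^-1)) y <=
    postmax m (update x s t) y - A^-1 by exact: postmax_shift.
  by move=> /le_trans; apply; rewrite -[leRHS]add0r lerD2r.
Qed.

(** Integrate postmax_section_le over the walk, and apply Markov's inequality to
   the overshoot at level 1 / A. *)
Lemma persistence_le_mean_overshoot m (A : R) : 1 <= A ->
  (persistence m <= (expR 1 * A)%:E * mean_overshoot m + (expR (2 - A))%:E)%E.
Proof.
move=> A1; have A0 : 0 < A by exact: lt_le_trans A1.
have mi c : measurable_fun setT (fun w : scenery * steps =>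
    (\1_[set w : scenery * steps | postmax m w.1 w.2 <= c] w)%:E : \bar R).
  by apply/measurable_EFinP; apply: measurable_indic; exact: measurable_postmax_le.
have indicPr c : (\int[Pr]_(w in setT)
    (\1_[set w : scenery * steps | (postmax m w.1 w.2 <= c)%R] w)%:E =
    Pr [set w : scenery * steps | (postmax m w.1 w.2 <= c)%R])%E.
  by rewrite integral_indic ?setIT//; exact: measurable_postmax_le.
have PrE c : (Pr [set w : scenery * steps | (postmax m w.1 w.2 <= c)%R] =
    \int[nu]_y mu [set x : scenery | (postmax m x y <= c)%R])%E.
  rewrite -[LHS]indicPr fubini_tonelli2//.
  apply: eq_integral => y _; rewrite /fubini_G/=.
  transitivity (\int[mu]_x
      (\1_[set x : scenery | (postmax m x y <= c)%R] x)%:E)%E; last first.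
    by rewrite integral_indic ?setIT//; exact: measurable_postmax_section.
  by apply: eq_integral => x _; rewrite !indicE; congr ((_ : bool)%:R%:E);
    apply/idP/idP; rewrite !inE.
have mmu c : measurable_fun setT
    (fun y : steps => mu [set x : scenery | (postmax m x y <= c)%R]).
  have := measurable_fun_ysection mu (measurable_postmax_le m c).
  congr (measurable_fun _ _); apply/funext => y /=; congr (mu _).
  by apply/seteqP; split => x /=; rewrite /ysection/= in_setE.
have h1 : (persistence m <= (expR 1)%:E *
    Pr [set w : scenery * steps | (postmax m w.1 w.2 <= - A^-1)%R] +
    (expR (2 - A))%:E)%E.
  rewrite /persistence !PrE -ge0_integralZl//.
  rewrite -[X in (_ <= _ + X)%E](integral_prob_cst nu).
  rewrite -ge0_integralD//; first last.
  - exact: emeasurable_funM.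
  - by move=> y _; rewrite mule_ge0 ?lee_fin ?expR_ge0.
  apply: ge0_le_integral => //.
    by apply: emeasurable_funD => //; exact: emeasurable_funM.
  by move=> y _; exact: postmax_section_le.
apply: (le_trans h1); rewrite leeD2r// EFinM -muleA.
rewrite lee_pmul2l// ?lte_fin ?expR_gt0//.
have mover : measurable_fun setT (fun w : scenery * steps =>
    (Num.max 0 (- postmax m w.1 w.2))%:E : \bar R).
  by apply: measurable_max0; apply: measurable_funN; exact: measurable_postmax.
rewrite -ge0_integralZl//; [|by move=> w _; rewrite lee_fin le_max lexx|
  by rewrite lee_fin ltW].
rewrite -indicPr; apply: ge0_le_integral => //.
- exact: emeasurable_funM.
- move=> w _; rewrite -EFinM lee_fin indicE.
  have [tU|_] := boolP (_ \in _); last first.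
    by apply: mulr_ge0; [exact: ltW|rewrite le_max lexx].
  rewrite inE /= in tU.
  rewrite -[leLHS](mulfV (lt0r_neq0 A0)) ler_pM2l// le_max; apply/orP; right.
  by rewrite lerNr.
Qed.

End persistence_recursion.

(** * Gaussian bounds on the mean maximum along a fixed walk *)

Lemma sum_undup_count (V : nmodType) (I : eqType) (s : seq I) (F : I -> V) :
  \sum_(i <- undup s) F i *+ count_mem i s = \sum_(i <- s) F i.
Proof.
rewrite -[RHS]big_undup_iterop_count; apply: eq_bigr => i _.
by rewrite Monoid.iteropE; elim: (count_mem i s) => //= n <-; rewrite mulrS.
Qed.

Section gaussian_maximum.
Context {R : realType} {d : nat}.
Notation scenery := (product_space (measurableTypeR R) (lattice d)).
Notation steps := (product_space (lattice d) nat).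
Implicit Types (y : nat -> lattice d).
Context (mu : probability scenery R).
Hypothesis gmu : iid_law (normal_prob 0 1) mu.

Lemma measurable_exp_linear (c : lattice d -> R) (s : seq (lattice d)) :
  measurable_fun setT
    (fun x : scenery => (expR (\sum_(a <- s) c a * (x a : R)))%:E).
Proof.
apply/measurable_EFinP; apply: (measurableT_comp (@measurable_expR R)).
apply: measurable_sum => a; apply: measurable_funM => //.
exact: measurable_coordinate.
Qed.

(** Resample the coordinates in s one at a time. *)
Lemma integral_exp_linear (c : lattice d -> R) (s : seq (lattice d)) : uniq s ->
  (\int[mu]_x (expR (\sum_(a <- s) c a * (x a : R)))%:E =
   (expR (\sum_(a <- s) c a ^+ 2 / 2))%:E)%E.
Proof.
elim: s => [|a s IH] /=.
  move=> _; rewrite big_nil.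
  under eq_integral do rewrite big_nil.
  exact: (integral_prob_cst mu).
move=> /andP[nas us].
have e0 (x : scenery) :
    (0 <= (expR (\sum_(b <- a :: s) c b * (x b : R)))%:E)%E.
  by rewrite lee_fin expR_ge0.
rewrite (integral_resample a gmu (measurable_exp_linear c (a :: s)) e0).
rewrite big_cons expRD EFinM -IH// -ge0_integralZl//; last 1 first.
- exact: measurable_exp_linear.
apply: eq_integral => x _.
transitivity (\int[normal_prob 0 1]_t ((expR (\sum_(b <- s) c b * (x b : R)))%:E
   * (expR (c a * t))%:E))%E.
  apply: eq_integral => t _; rewrite -EFinM -expRD addrC big_cons.
  rewrite [update x a t a]/update eqxx.
  suff -> : \sum_(b <- s) c b * (update x a t b : R) =
      \sum_(b <- s) c b * (x b : R) by [].
  rewrite big_seq [RHS]big_seq; apply: eq_bigr => b bs; rewrite /update.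
  by case: eqP => // ba; rewrite -ba bs in nas.
rewrite ge0_integralZl//; last 1 first.
- apply/measurable_EFinP; apply: (measurableT_comp (@measurable_expR R)).
  exact: measurable_funM.
by rewrite normal_prob_mgf muleC.
Qed.

Definition sites y n : seq (lattice d) := [seq position y (i : 'I_n).+1 | i : 'I_n].

(** The variance of the sum of the scenery along the walk y up to time n. *)
Definition self_intersections y n : R :=
  \sum_(i < n) \sum_(j < n) (position y i.+1 == position y j.+1)%:R.

Lemma scenery_sum_sites (x : lattice d -> R) y n :
  scenery_sum x y n = \sum_(a <- sites y n) x a.
Proof. by rewrite big_map big_enum. Qed.

Lemma self_intersections_sites y n :
  self_intersections y n =
  \sum_(a <- undup (sites y n)) (count_mem a (sites y n))%:R ^+ 2.
Proof.
transitivity (\sum_(a <- sites y n) (count_mem a (sites y n))%:R : R).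
  rewrite /self_intersections [RHS]big_map big_enum; apply: eq_bigr => i _.
  rewrite -sum1_count big_map big_enum_cond/= natr_sum [RHS]big_mkcond/=.
  by apply: eq_bigr => j _; rewrite eq_sym; case: eqP.
rewrite -sum_undup_count; apply: eq_bigr => a _.
by rewrite expr2 mulr_natr.
Qed.

(** Group the terms by site: the sum is the linear form in the scenery whose
   coefficients are the local times, and the sum of their squares counts the
   pairs of times at the same site. *)
Lemma integral_exp_scenery_sum y n (l : R) :
  (\int[mu]_x (expR (l * scenery_sum (x : scenery) y n))%:E =
   (expR (l ^+ 2 * self_intersections y n / 2))%:E)%E.
Proof.
have := integral_exp_linear (fun a => l * (count_mem a (sites y n))%:R)
  (undup_uniq (sites y n)).
rewrite -mulr_suml.
have -> : \sum_(a <- undup (sites y n)) (l * (count_mem a (sites y n))%:R) ^+ 2 =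
    l ^+ 2 * self_intersections y n.
  by rewrite self_intersections_sites mulr_sumr; apply: eq_bigr => a _;
    rewrite exprMn.
move=> <-; apply: eq_integral => x _; congr ((expR _)%:E).
rewrite scenery_sum_sites -sum_undup_count mulr_sumr; apply: eq_bigr => a _.
by rewrite -mulrA mulr_natl.
Qed.

Lemma self_intersections_ge y n : n%:R <= self_intersections y n.
Proof.
rewrite -[leLHS]mulr1 -[n in n%:R]card_ord mulr_natl -sumr_const.
apply: ler_sum => i _; rewrite (bigD1 i)//= eqxx lerDl.
by apply: sumr_ge0.
Qed.

Lemma le_self_intersections y m n : (m <= n)%N ->
  self_intersections y m <= self_intersections y n.
Proof.
move=> mn.
rewrite /self_intersections (big_ord_widen n
  (fun i => \sum_(j < m) (position y i.+1 == position y j.+1)%:R))//.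
rewrite big_mkcond; apply: ler_sum => i _.
have h : \sum_(j < m) (position y i.+1 == position y j.+1)%:R <=
  \sum_(j < n) (position y i.+1 == position y j.+1)%:R :> R.
  rewrite (big_ord_widen n (fun j => (position y i.+1 == position y j.+1)%:R))//.
  by rewrite big_mkcond; apply: ler_sum => j _; case: ifP.
by case: ifP => // _; apply: sumr_ge0.
Qed.

Lemma measurable_runmax_section y n :
  measurable_fun setT (fun x : scenery => (runmax n x y)%:E).
Proof.
apply/measurable_EFinP.
exact: (measurableT_comp (@measurable_runmax R d n)
  (@measurable_pair2 _ _ scenery steps y)).
Qed.

Lemma measurable_exp_scenery_sum y n (l : R) :
  measurable_fun setT (fun x : scenery => (expR (l * scenery_sum x y n))%:E).
Proof.
apply/measurable_EFinP; apply: (measurableT_comp (@measurable_expR R)).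
apply: measurable_funM => //.
exact: (measurableT_comp (@measurable_scenery_sum R d n)
  (@measurable_pair2 _ _ scenery steps y)).
Qed.

(** Three cases: t <= 0; 0 < t <= 3, where exp t <= 1 + t exp t; and t > 3, where
   exp t <= exp (2 t - 3). *)
Lemma expR_le_split (t u : R) : 0 <= u -> t <= u ->
  expR t <= 1 + expR 3 * u + expR (- 3) * expR (2 * t).
Proof.
move=> u0 tu.
have e3 : 0 <= expR 3 * u by rewrite mulr_ge0// expR_ge0.
have e23 : 0 <= expR (- 3) * expR (2 * t) :> R by rewrite mulr_ge0// expR_ge0.
have [t0|t0] := leP t 0.
  have : expR t <= 1 by rewrite -expR0 ler_expR.
  by move: e3 e23; lra.
have [t3|t3] := leP t 3.
  have h1 : expR t <= 1 + t * expR t.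
    have := expR_ge1Dx (- t); rewrite expRN -(ler_pM2r (expR_gt0 t)).
    by rewrite mulVf ?gt_eqF ?expR_gt0// mulrDl mul1r mulNr; lra.
  have h2 : t * expR t <= u * expR 3.
    by apply: ler_pM; rewrite ?expR_ge0 ?ler_expR// ltW.
  by move: h1 h2 e23; rewrite [u * _]mulrC; lra.
have : expR t <= expR (- 3) * expR (2 * t).
  by rewrite -expRD ler_expR; lra.
by move: e3; lra.
Qed.

(** The lower bound on the mean of u that results from integrating expR_le_split
   when t is a standard Gaussian variable, whose exponential moments of orders 1
   and 2 are exp(1/2) and exp 2. *)
Definition gaussian_constant : R := expR (- 3) * (expR 2^-1 - 1 - expR (- 1)).

Lemma gaussian_constant_gt0 : 0 < gaussian_constant.
Proof.
rewrite mulr_gt0 ?expR_gt0//.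
have h1 := @expR_ge1Dx R 2^-1.
have h2 : (2 : R) < expR 1.
  by have := @expR_gt1Dx R 1 (oner_neq0 _); rewrite -natr1 addrC.
have h3 : expR (- 1) < 2^-1 :> R.
  by rewrite expRN ltf_pV2 ?posrE ?expR_gt0.
by lra.
Qed.

(** Integrate expR_le_split with t the sum at time n divided by its standard
   deviation: this bounds the mean of the positive part from below. *)
Lemma integral_runmax_ge y n : (0 < n)%N ->
  ((gaussian_constant * Num.sqrt n%:R)%:E <=
   \int[mu]_x (runmax n (x : scenery) y)%:E)%E.
Proof.
move=> n0; set V := self_intersections y n.
have nV : n%:R <= V by exact: self_intersections_ge.
have V0 : 0 < V by apply: lt_le_trans nV; rewrite ltr0n.
pose q := Num.sqrt V.
have q0 : 0 < q by rewrite sqrtr_gt0.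
have qV : q ^+ 2 = V by rewrite sqr_sqrtr// ltW.
pose I := (\int[mu]_x (runmax n (x : scenery) y)%:E)%E.
have I0 : (0 <= I)%E by apply: integral_ge0 => x _; rewrite lee_fin runmax_ge0.
have mM := measurable_runmax_section y n.
have key : ((expR 2^-1)%:E <=
    (1 + (expR 3 / q)%:E * I + (expR (- 3) * expR 2)%:E))%E.
  have -> : ((expR 2^-1)%:E =
      \int[mu]_x (expR (q^-1 * scenery_sum (x : scenery) y n))%:E)%E.
    rewrite integral_exp_scenery_sum -/V -qV; congr ((expR _)%:E).
    by field; rewrite gt_eqF.
  have -> : ((expR (- 3) * expR 2)%:E = (expR (- 3))%:E *
      \int[mu]_x (expR (2 / q * scenery_sum (x : scenery) y n))%:E)%E.
    rewrite integral_exp_scenery_sum -/V -qV -EFinM; congr ((_ * expR _)%:E).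
    by field; rewrite gt_eqF.
  have mE l := measurable_exp_scenery_sum y n l.
  have c0 : (0 <= (expR 3 / q)%:E)%E by rewrite lee_fin divr_ge0// ?expR_ge0// ltW.
  have c0' : (0 <= (expR (- 3) : R)%:E)%E by rewrite lee_fin expR_ge0.
  have n1 : measurable_fun setT
      (fun x : scenery => ((expR 3 / q)%:E * (runmax n x y)%:E)%E).
    exact: emeasurable_funM.
  have n2 : measurable_fun setT (fun x : scenery =>
      ((expR (- 3))%:E * (expR (2 / q * scenery_sum x y n))%:E)%E).
    exact: emeasurable_funM.
  have M0 (x : scenery) : (0 <= (runmax n x y)%:E)%E by rewrite lee_fin runmax_ge0.
  have p1 (x : scenery) : (0 <= (expR 3 / q)%:E * (runmax n x y)%:E)%E.
    exact: mule_ge0.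
  have p2 (x : scenery) : (0 <= (expR (- 3))%:E *
      (expR (2 / q * scenery_sum x y n))%:E)%E.
    by rewrite mule_ge0// lee_fin expR_ge0.
  rewrite /I -ge0_integralZl// -ge0_integralZl//.
  rewrite -[X in (_ <= X + _ + _)%E](integral_prob_cst mu).
  rewrite -ge0_integralD// -ge0_integralD//; last 2 first.
  - by move=> x _; rewrite adde_ge0.
  - exact: emeasurable_funD.
  apply: ge0_le_integral => //.
    by apply: emeasurable_funD => //; exact: emeasurable_funD.
  move=> x _; rewrite -!EFinM -!EFinD lee_fin.
  have := @expR_le_split (q^-1 * scenery_sum x y n) (q^-1 * runmax n x y).
  rewrite !mulrA; apply.
    by rewrite mulr_ge0 ?runmax_ge0// invr_ge0 ltW.
  by rewrite ler_pM2l ?invr_gt0// scenery_sum_le_runmax.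
rewrite -/I; move: I0 key; case: I => [v| |]//=; last by move=> _ _; exact: leey.
rewrite -!EFinM -!EFinD !lee_fin => v0 key.
have h : gaussian_constant * q <= v.
  rewrite -ler_pdivlMr//. 
  rewrite /gaussian_constant -(ler_pM2l (expR_gt0 3)) mulrA -expRD subrr expR0 mul1r.
  have e1 : expR (- 3) * expR 2 = expR (- 1) :> R by rewrite -expRD; congr expR; ring.
  by move: key; rewrite e1 (_ : expR 3 / q * v = expR 3 * (v / q)); [lra|ring].
apply: le_trans h; rewrite ler_pM2l ?gaussian_constant_gt0//.
by rewrite ler_sqrt// ltW.
Qed.

(** With q the standard deviation at time n, each sum is at most q ln n plus
   q exp(sum / q - ln n), because v <= exp v. Adding the last terms over k makes
   this a bound on the maximum; each has mean at most 2 q / n. *)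
Lemma integral_runmax_le y n : (0 < n)%N ->
  (\int[mu]_x (runmax n (x : scenery) y)%:E <=
   ((ln n%:R + 2) * Num.sqrt (self_intersections y n))%:E)%E.
Proof.
move=> n0; set V := self_intersections y n.
have nV : n%:R <= V by exact: self_intersections_ge.
have V0 : 0 < V by apply: lt_le_trans nV; rewrite ltr0n.
pose q := Num.sqrt V.
have q0 : 0 < q by rewrite sqrtr_gt0.
have qV : q ^+ 2 = V by rewrite sqr_sqrtr// ltW.
have nn0 : 0 < n%:R :> R by rewrite ltr0n.
have ln0 : 0 <= ln (n%:R : R) by rewrite ln_ge0// ler1n.
pose f (k : nat) (x : scenery) : \bar R :=
  ((q / n%:R)%:E * (expR (q^-1 * scenery_sum x y k))%:E)%E.
have mE k := measurable_exp_scenery_sum y k q^-1.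
have c0 : (0 <= (q / n%:R)%:E)%E by rewrite lee_fin divr_ge0// ltW.
have mf k : measurable_fun setT (f k) by exact: emeasurable_funM.
have f0 k x : (0 <= f k x)%E by rewrite mule_ge0// lee_fin expR_ge0.
have If k : (k <= n)%N -> (\int[mu]_x f k x <= (q / n%:R * 2)%:E)%E.
  move=> kn; rewrite ge0_integralZl// integral_exp_scenery_sum -EFinM lee_fin.
  apply: ler_wpM2l; first by rewrite divr_ge0// ltW.
  have h : q^-1 ^+ 2 * self_intersections y k / 2 <= 2^-1.
    rewrite exprVn qV ler_pdivrMr// mulVf// mulrC ler_pdivrMr// mul1r.
    exact: le_self_intersections.
  apply: (@le_trans _ _ (expR 2^-1)); first by rewrite ler_expR.
  have := @expR_ge1Dx R (- 2^-1); rewrite expRN => h2.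
  have e0 := expR_gt0 (2^-1 : R).
  rewrite -[leLHS]invrK -[leRHS]invrK lef_pV2 ?posrE ?invr_gt0//.
  by apply: le_trans h2; lra.
apply: (@le_trans _ _ (\int[mu]_x ((q * ln n%:R)%:E + \sum_(k < n) f k.+1 x))%E).
  apply: ge0_le_integral => //.
  - by move=> x _; rewrite lee_fin runmax_ge0.
  - exact: measurable_runmax_section.
  - by apply: emeasurable_funD => //; apply: emeasurable_sum => k; exact: mf.
  - move=> x _; rewrite /f; under eq_bigr do rewrite -EFinM.
    rewrite sumEFin -EFinD lee_fin.
    have s0 (k : nat) : 0 <= q / n%:R * expR (q^-1 * scenery_sum x y k).
      by rewrite mulr_ge0 ?expR_ge0// divr_ge0// ltW.
    apply/runmax_le => -[|k] kn.
      rewrite scenery_sum0 addr_ge0//; first by rewrite mulr_ge0// ltW.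
      by apply: sumr_ge0.
    apply: (@le_trans _ _ (q * ln n%:R +
        q / n%:R * expR (q^-1 * scenery_sum x y k.+1))); last first.
      rewrite lerD2l (bigD1 (Ordinal kn))//= lerDl.
      by apply: sumr_ge0.
    rewrite -mulrA -mulrDr -ler_pdivrMl//.
    set t := q^-1 * _.
    have -> : n%:R^-1 * expR t = expR (t - ln n%:R).
      by rewrite expRD expRN lnK ?posrE// mulrC.
    by have := expR_ge1Dx (t - ln n%:R); lra.
rewrite ge0_integralD//; last 3 first.
- by rewrite lee_fin mulr_ge0// ltW.
- by move=> x _; apply: sume_ge0.
- by apply: emeasurable_sum => k; exact: mf.
rewrite (integral_prob_cst mu) ge0_integral_sum//.
apply: (@le_trans _ _ ((q * ln n%:R)%:E + \sum_(k < n) (q / n%:R * 2)%:E)%E).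
  by apply: leeD2l; apply: lee_sum => k _; exact: If.
rewrite sumEFin -EFinD lee_fin sumr_const card_ord -[_ *+ n]mulr_natr.
rewrite -/q le_eqVlt; apply/orP; left; apply/eqP.
by field; rewrite gt_eqF.
Qed.

End gaussian_maximum.

(** * Self-intersections and the Green function *)

(** Each distance to i is taken at most twice. *)
Lemma sum_distance_le (R : numDomainType) (u : nat -> R) (n i : nat) :
  (forall k, 0 <= u k) -> (i < n)%N ->
  \sum_(j < n) u ((i - j) + (j - i))%N <= 2 * \sum_(k < n) u k.
Proof.
move=> u0 i_n.
have sub m : (m <= n)%N -> \sum_(0 <= k < m) u k <= \sum_(0 <= k < n) u k.
  move=> mn; rewrite [leRHS](big_cat_nat (n := m))//= lerDl.
  by apply: sumr_ge0.
rewrite -!(big_mkord xpredT (fun j => u ((i - j) + (j - i))%N)).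
rewrite -(big_mkord xpredT u).
rewrite (big_cat_nat (n := i))//=; last exact: ltnW.
rewrite mulr_natl mulr2n; apply: lerD.
  rewrite big_nat_rev/= add0n.
  apply: (@le_trans _ _ (\sum_(0 <= k < i.+1) u k)); last exact: sub.
  rewrite [leRHS]big_nat_recl//= -[leLHS]add0r; apply: lerD => //.
  rewrite le_eqVlt; apply/orP; left; apply/eqP.
  apply: eq_big_nat => k /andP[_ ki]; congr u.
  by lia.
rewrite -{1}[i]add0n big_addn.
apply: le_trans (sub (n - i)%N (leq_subr _ _)).
rewrite le_eqVlt; apply/orP; left; apply/eqP.
by apply: eq_big_nat => k _; congr u; lia.
Qed.

Section green_function.
Context {R : realType} {d : nat}.
Notation steps := (product_space (lattice d) nat).
Context (r : probability (lattice d) R) (nu : probability steps R).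
Hypothesis rnu : iid_law r nu.

Definition return_prob k : R := fine (nu [set y : steps | position y k = 0]).

Lemma measurable_steps_pred (b : steps -> lattice d) (A : set (lattice d)) :
  measurable_fun setT b -> measurable (b @^-1` A).
Proof. by move=> mb; rewrite -[X in measurable X]setTI; exact: mb. Qed.

Lemma return_probE k :
  nu [set y : steps | position y k = 0] = (return_prob k)%:E.
Proof.
rewrite fineK// fin_num_measure//.
exact: (measurable_steps_pred [set 0] (measurable_position k)).
Qed.

Lemma return_prob_ge0 k : 0 <= return_prob k.
Proof. by rewrite fine_ge0. Qed.

Lemma measurable_meet i j :
  measurable [set y : steps | position y i = position y j].
Proof.
have -> : [set y : steps | position y i = position y j] =
    (fun y : steps => position y i + - position y j) @^-1` [set 0].
  apply/seteqP; split => y /=; first by move=> ->; rewrite subrr.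
  by move=> /eqP; rewrite subr_eq0 => /eqP.
apply: measurable_steps_pred; apply: measurable_latticeD.
  exact: measurable_position.
by apply: measurable_latticeN; exact: measurable_position.
Qed.

Lemma integral_meet i j :
  (\int[nu]_y ((position (y : steps) i == position y j)%:R : R)%:E =
   nu [set y : steps | position y i = position y j])%E.
Proof.
have := measurable_meet i j; set A := [set y | _] => mA.
transitivity (\int[nu]_y (\1_A y)%:E)%E; last by rewrite integral_indic ?setIT.
apply: eq_integral => y _; rewrite indicE; congr ((_ : bool)%:R%:E).
by apply/eqP/idP; rewrite inE.
Qed.

(** Stationarity of the steps: remove the first one. *)
Lemma meet_prob i k :
  (nu [set y : steps | position y i = position y (i + k)%N] =
   (return_prob k)%:E)%E.
Proof.
elim: i => [|i IH].
  rewrite -return_probE; congr (nu _); apply/seteqP; split => y /=;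
    by rewrite position0 add0n => <-.
rewrite -IH -!integral_meet.
rewrite -[RHS](integral_stail rnu)//; last first.
  apply/measurable_EFinP.
  rewrite (_ : (fun y : steps => _) =
    \1_[set y : steps | position y i = position y (i + k)%N]).
    by apply: measurable_indic; exact: measurable_meet.
  apply/funext => y; rewrite indicE; congr ((_ : bool)%:R).
  by apply/eqP/idP; rewrite inE.
apply: eq_integral => y _.
by rewrite addSn !positionS (inj_eq (addrI _)).
Qed.

Lemma meet_prob_distance i j :
  (nu [set y : steps | position y i = position y j] =
   (return_prob ((i - j) + (j - i))%N)%:E)%E.
Proof.
have [ij|ji] := leqP i j.
  by rewrite -(meet_prob i); congr (nu _); rewrite (_ : (i + _)%N = j)//; lia.
rewrite -(meet_prob j); congr (nu _); rewrite (_ : (j + _)%N = i); last by lia.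
by apply/seteqP; split => y /= ->.
Qed.

Lemma measurable_self_intersections n :
  measurable_fun setT (fun y : steps => self_intersections y n : R).
Proof.
apply: measurable_sum => i; apply: measurable_sum => j.
rewrite (_ : (fun y : steps => _) =
  \1_[set y : steps | position y i.+1 = position y j.+1]).
  by apply: measurable_indic; exact: measurable_meet.
apply/funext => y; rewrite indicE; congr ((_ : bool)%:R).
by apply/eqP/idP; rewrite inE.
Qed.

Definition green n : R := \sum_(k < n) return_prob k.

Lemma integral_self_intersections_le n :
  (\int[nu]_y (self_intersections (y : steps) n : R)%:E <=
   (2 * n%:R * green n)%:E)%E.
Proof.
have mb i j : measurable_fun setT (fun y : steps =>
    ((position y i == position y j)%:R : R)%:E).
  apply/measurable_EFinP.
  rewrite (_ : (fun y : steps => _) = \1_[set y : steps | position y i = position y j]).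
    by apply: measurable_indic; exact: measurable_meet.
  apply/funext => y; rewrite indicE; congr ((_ : bool)%:R).
  by apply/eqP/idP; rewrite inE.
rewrite /self_intersections.
under eq_integral => y _.
  rewrite -sumEFin.
  under eq_bigr do rewrite -sumEFin.
  over.
rewrite ge0_integral_sum//; last 2 first.
- by move=> i; apply: emeasurable_sum => j; exact: mb.
- by move=> i y _; apply: sume_ge0 => j _; rewrite lee_fin.
under eq_bigr => i _.
  rewrite ge0_integral_sum//.
  under eq_bigr => j _ do rewrite integral_meet meet_prob_distance !subSS.
  rewrite sumEFin.
  over.
rewrite sumEFin lee_fin.
apply: (@le_trans _ _ (\sum_(i < n) (2 * green n))).
  by apply: ler_sum => i _; apply: sum_distance_le => // k; exact: return_prob_ge0.
by rewrite sumr_const card_ord -[leLHS]mulr_natr mulrAC.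
Qed.

Section mean_runmax_bounds.
Notation scenery := (product_space (measurableTypeR R) (lattice d)).
Context (mu : probability scenery R).
Hypothesis gmu : iid_law (normal_prob 0 1) mu.

Lemma mean_runmaxE n :
  (mean_runmax mu nu n =
   \int[nu]_y \int[mu]_x (runmax n (x : scenery) y)%:E)%E.
Proof.
rewrite /mean_runmax fubini_tonelli2//.
- by apply/measurable_EFinP; exact: measurable_runmax.
- by move=> w; rewrite lee_fin runmax_ge0.
Qed.

Lemma measurable_mean_runmax_section n : measurable_fun setT
  (fun y : steps => \int[mu]_x (runmax n (x : scenery) y)%:E)%E.
Proof.
have mf : measurable_fun setT
    (fun w : scenery * steps => (runmax n w.1 w.2)%:E : \bar R).
  by apply/measurable_EFinP; exact: measurable_runmax.
have := @measurable_fun_fubini_tonelli_G _ _ _ _ _ mu _ mf.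
by apply => w; rewrite lee_fin runmax_ge0.
Qed.

Lemma mean_runmax_ge n : (0 < n)%N ->
  ((gaussian_constant * Num.sqrt n%:R)%:E <= mean_runmax mu nu n)%E.
Proof.
move=> n0; rewrite mean_runmaxE -[leLHS](integral_prob_cst nu).
apply: ge0_le_integral => //.
- move=> y _; rewrite lee_fin mulr_ge0// ?sqrtr_ge0// ltW//.
  exact: gaussian_constant_gt0.
- exact: measurable_mean_runmax_section.
- by move=> y _; exact: integral_runmax_ge.
Qed.

(** Jensen's inequality for the square root, in the form
   sqrt V <= V / (2 K) + K / 2 with K^2 the bound on the mean of V. *)
Lemma mean_runmax_le n (G : R) : (0 < n)%N -> 0 < G -> green n <= G ->
  (mean_runmax mu nu n <=
   ((ln n%:R + 2) * Num.sqrt (2 * n%:R * G))%:E)%E.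
Proof.
move=> n0 G0 gG; pose K := Num.sqrt (2 * n%:R * G).
have nn0 : 0 < n%:R :> R by rewrite ltr0n.
have K0 : 0 < K by rewrite sqrtr_gt0 !mulr_gt0.
have KK : K ^+ 2 = 2 * n%:R * G by rewrite sqr_sqrtr// !mulr_ge0// ltW.
have l0 : 0 <= ln n%:R + 2 :> R by rewrite addr_ge0// ln_ge0// ler1n.
pose c := (ln n%:R + 2) / (2 * K).
have c0 : 0 <= c by rewrite divr_ge0// mulr_ge0// ltW.
rewrite mean_runmaxE.
apply: (@le_trans _ _ (\int[nu]_y (c%:E * (self_intersections y n)%:E +
    ((ln n%:R + 2) * K / 2)%:E))%E).
  apply: ge0_le_integral => //.
  - by move=> y _; apply: integral_ge0 => x _; rewrite lee_fin runmax_ge0.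
  - exact: measurable_mean_runmax_section.
  - apply: emeasurable_funD => //; apply: emeasurable_funM => //.
    by apply/measurable_EFinP; exact: measurable_self_intersections.
  - move=> y _; apply: (le_trans (integral_runmax_le gmu y n0)).
    rewrite -EFinM -EFinD lee_fin; set V := self_intersections y n.
    have V0 : 0 <= V.
      by apply: le_trans (self_intersections_ge y n); rewrite ler0n.
    pose q := Num.sqrt V; have qV : q ^+ 2 = V by rewrite sqr_sqrtr.
    rewrite -/q -qV.
    have -> : c * q ^+ 2 + (ln n%:R + 2) * K / 2 =
        (ln n%:R + 2) * ((q ^+ 2 + K ^+ 2) / (2 * K)).
      by rewrite /c; field; rewrite gt_eqF.
    rewrite ler_wpM2l// ler_pdivlMr ?mulr_gt0//.
    by have := sqr_ge0 (q - K); rewrite sqrrB; lra.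
rewrite ge0_integralD//; last 3 first.
- move=> y _; rewrite mule_ge0// lee_fin.
  by apply: le_trans (self_intersections_ge y n); rewrite ler0n.
- apply: emeasurable_funM => //.
  by apply/measurable_EFinP; exact: measurable_self_intersections.
- by rewrite lee_fin divr_ge0// mulr_ge0// ltW.
rewrite (integral_prob_cst nu) ge0_integralZl//; last 2 first.
- by apply/measurable_EFinP; exact: measurable_self_intersections.
- move=> y _; rewrite lee_fin.
  by apply: le_trans (self_intersections_ge y n); rewrite ler0n.
apply: (@le_trans _ _ (c%:E * (2 * n%:R * green n)%:E +
    ((ln n%:R + 2) * K / 2)%:E)%E).
  apply: leeD2r; apply: lee_wpmul2l => //.
  exact: integral_self_intersections_le.
rewrite -EFinM -EFinD lee_fin.
apply: (@le_trans _ _ (c * K ^+ 2 + (ln n%:R + 2) * K / 2)).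
  by rewrite lerD2r ler_wpM2l// KK ler_wpM2l// mulr_ge0// ltW.
rewrite le_eqVlt; apply/orP; left; apply/eqP.
by rewrite /c -/K; field; rewrite gt_eqF.
Qed.

End mean_runmax_bounds.
End green_function.

(** * Transient walks *)

Section transient_green.
Context {R : realType} {d : nat}.
Notation steps := (product_space (lattice d) nat).
Context (r : probability (lattice d) R) (nu : probability steps R).
Hypothesis rnu : iid_law r nu.

Lemma position_iter (y : nat -> lattice d) k j :
  position y (k + j) = position y k + position (iter k stail y) j.
Proof.
elim: k y => [|k IH] y; first by rewrite position0 add0r.
by rewrite addSn !positionS IH addrA iterSr.
Qed.

Lemma measurable_iter_stail k :
  measurable_fun setT (fun y : steps => iter k stail y : steps).
Proof.
elim: k => [|k IH] /=; first exact: measurable_id.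
exact: (measurableT_comp measurable_stail IH).
Qed.

Definition hits (a : lattice d) (k : nat) (y : steps) : R :=
  (a + position y k == 0)%:R.

Lemma measurable_hits a k : measurable_fun setT (fun y : steps => (hits a k y)%:E).
Proof.
apply: (measurableT_comp (f := fun b : lattice d => ((a + b == 0)%:R : R)%:E)).
  exact: measurable_lattice_fun.
exact: measurable_position.
Qed.

Lemma hitsS a k t (y : steps) :
  hits a k.+1 (scons t y) = hits (a + t) k y.
Proof. by rewrite /hits positionS /= addrA. Qed.

Lemma measurable_hits_future a k m (h : steps -> R) : measurable_fun setT h ->
  measurable_fun setT (fun y : steps => (hits a k y * h (iter m stail y))%:E).
Proof.
move=> mh; apply/measurable_EFinP; apply: measurable_funM.
  by apply/measurable_EFinP; exact: measurable_hits.
exact: (measurableT_comp mh (measurable_iter_stail m)).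
Qed.

(** The walk after time k is independent of its position at time k. *)
Lemma integral_hits_future a k (h : steps -> R) :
  measurable_fun setT h -> (forall y, 0 <= h y) ->
  (\int[nu]_y (hits a k y * h (iter k stail y))%:E =
   \int[nu]_y (hits a k y)%:E * \int[nu]_y (h y)%:E)%E.
Proof.
move=> mh h0.
have mhE : measurable_fun setT (fun y : steps => (h y)%:E) by exact/measurable_EFinP.
have H0 : (0 <= \int[nu]_y (h y)%:E)%E.
  by apply: integral_ge0 => y _; rewrite lee_fin.
elim: k a => [|k IH] a.
  have hE (y : steps) : hits a 0 y = (a == 0)%:R by rewrite /hits position0 addr0.
  under eq_integral do rewrite hE EFinM.
  rewrite ge0_integralZl//; last by move=> y _; rewrite lee_fin.
  congr (_ * _)%E; under eq_integral do rewrite hE.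
  exact/esym/(integral_prob_cst nu).
rewrite (integral_scons rnu)//; last 2 first.
- exact: measurable_hits_future.
- by move=> y; rewrite lee_fin mulr_ge0.
rewrite [in RHS](integral_scons rnu)//; last 2 first.
- exact: measurable_hits.
- by move=> y; rewrite lee_fin.
rewrite -ge0_integralZr//.
- apply: eq_integral => t _; rewrite -[X in (_ = X * _)%E]/(integral nu _ _).
  under eq_integral do rewrite hitsS iterSr.
  by rewrite IH; under [in RHS]eq_integral do rewrite hitsS.
- by move=> t _; apply: integral_ge0 => y _; rewrite lee_fin.
Qed.

Definition no_return (T : nat) (y : steps) : R :=
  [forall j : 'I_T, position y j.+1 != 0]%:R.

Lemma measurable_no_return T : measurable_fun setT (no_return T).
Proof.
have -> : no_return T = fun y => \prod_(j < T) (1 - hits 0 j.+1 y).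
  apply/funext => y; rewrite /no_return.
  have [/forallP h|/forallPn[j hj]] :=
      boolP [forall j : 'I_T, position y j.+1 != 0].
    by rewrite big1// => j _; rewrite /hits add0r (negbTE (h j)) subr0.
  rewrite (bigD1 j)//= /hits add0r; move: hj; rewrite negbK => ->.
  by rewrite subrr mul0r.
apply: measurable_prod => j _; apply: measurable_funB => //.
by apply/measurable_EFinP; exact: measurable_hits.
Qed.

Lemma sum_last_visit_le1 T (y : steps) :
  \sum_(k < T) hits 0 k y * no_return T (iter k stail y) <= 1.
Proof.
have b01 (k : nat) : hits 0 k y * no_return T (iter k stail y) =
    ((position y k == 0) && [forall j : 'I_T,
       position (iter k stail y) j.+1 != 0])%:R.
  by rewrite /hits /no_return add0r -natrM mulnb.
have [/existsP[k kP]|/existsPn h] := boolP [exists k : 'I_T,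
    (position y k == 0) && [forall j : 'I_T,
       position (iter k stail y) j.+1 != 0]]; last first.
  by rewrite big1// => k _; rewrite b01 (negbTE (h k)).
rewrite (bigD1 k)//= b01 kP big1 ?addr0// => l lk.
rewrite b01; case: eqP => //= yl; case: forallP => // lP; exfalso.
have /andP[/eqP yk /forallP kP'] := kP.
have [kl|lk'|/val_inj kl] := ltngtP k l; last by rewrite kl eqxx in lk.
  have jT : (l - k.+1 < T)%N by rewrite (leq_ltn_trans (leq_subr _ _)).
  have /eqP := kP' (Ordinal jT); apply => /=.
  have := position_iter y k (l - k.+1).+1.
  by rewrite yk add0r => <-; rewrite -yl; congr (position _ _); lia.
have jT : (k - l.+1 < T)%N by rewrite (leq_ltn_trans (leq_subr _ _)).
have /eqP := lP (Ordinal jT); apply => /=.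
have := position_iter y l (k - l.+1).+1.
by rewrite yl add0r => <-; rewrite -yk; congr (position _ _); lia.
Qed.

Lemma integral_hits0 k : (\int[nu]_y (hits 0 k y)%:E = (return_prob nu k)%:E)%E.
Proof.
rewrite -return_probE.
transitivity (\int[nu]_y (\1_[set y : steps | position y k = 0] y)%:E)%E.
  apply: eq_integral => y _; rewrite /hits add0r indicE.
  by congr ((_ : bool)%:R%:E); apply/eqP/idP; rewrite inE.
rewrite integral_indic ?setIT//.
exact: (measurable_steps_pred [set 0] (measurable_position k)).
Qed.

(** Decompose according to the last visit to the origin before time n, a visit
   being called last when the walk does not come back within the n following
   steps: these events are disjoint, and each has probability P(S_k = 0) times
   at least the probability q of never returning. *)
Lemma transient_green_le :
  (nu [set y : steps | exists n, (0 < n)%N /\ position y n = 0%R] < 1)%E ->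
  exists2 C : R, 0 < C & forall n, green nu n <= C.
Proof.
set A := [set y | _] => A1.
have mA : measurable A.
  have -> : A = \bigcup_n [set y : steps | position y n.+1 = 0].
    apply/seteqP; split => y /=; first by move=> [[|n] [n0 yn]] //; exists n.
    by move=> [n _ /= yn]; exists n.+1.
  apply: bigcupT_measurable => n.
  exact: (measurable_steps_pred [set 0] (measurable_position n.+1)).
pose q := fine (nu (~` A)).
have qE : nu (~` A) = q%:E.
  by rewrite fineK// fin_num_measure//; exact: measurableC.
have q0 : 0 < q.
  rewrite -lte_fin -qE probability_setC// sube_gt0//.
exists q^-1 => [|n]; first by rewrite invr_gt0.
rewrite -[q^-1]mul1r ler_pdivlMr//.
have mno : measurable_fun setT (fun y : steps => (no_return n y)%:E).
  by apply/measurable_EFinP; exact: measurable_no_return.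
have no0 (y : steps) : 0 <= no_return n y by rewrite ler0n.
have qno : (q%:E <= \int[nu]_y (no_return n y)%:E)%E.
  have -> : (q%:E = \int[nu]_y (\1_(~` A) y)%:E)%E.
    by rewrite integral_indic ?setIT ?qE//; exact: measurableC.
  apply: ge0_le_integral => //.
    by apply/measurable_EFinP; apply: measurable_indic; exact: measurableC.
  move=> y _; rewrite lee_fin indicE.
  have [yA|_] := boolP (y \in _); last by rewrite ler0n.
  rewrite /no_return; case: forallP => // h; exfalso; apply: h => j.
  apply/eqP => yj; rewrite inE in yA; apply: yA.
  by exists j.+1.
have : ((\sum_(k < n) return_prob nu k * q)%:E <= 1)%E.
  rewrite -[leRHS](integral_prob_cst nu).
  apply: (@le_trans _ _ (\int[nu]_y
      \sum_(k < n) (hits 0 k y * no_return n (iter k stail y))%:E)%E); last first.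
    apply: ge0_le_integral => //.
    - by move=> y _; apply: sume_ge0 => k _; rewrite lee_fin mulr_ge0.
    - apply: emeasurable_sum => k; apply: measurable_hits_future.
      exact: measurable_no_return.
    - by move=> y _; rewrite sumEFin lee_fin; exact: sum_last_visit_le1.
  rewrite ge0_integral_sum//; last 2 first.
  - move=> k; apply: measurable_hits_future; exact: measurable_no_return.
  - by move=> k y _; rewrite lee_fin mulr_ge0.
  rewrite -sumEFin; apply: lee_sum => k _.
  rewrite integral_hits_future//; last exact: measurable_no_return.
  rewrite integral_hits0 EFinM; apply: lee_wpmul2l => //.
  by rewrite lee_fin return_prob_ge0.
by rewrite lee_fin /green mulr_suml.
Qed.

End transient_green.

(** * Planar walks with non-singular covariance *)

Lemma bin_le_central m i : ('C(m.*2, i) <= 'C(m.*2, m))%N.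
Proof.
have up j : (j < m)%N -> ('C(m.*2, j) <= 'C(m.*2, j.+1))%N.
  move=> jm; rewrite -(leq_pmul2l (ltn0Sn j)) mul_bin_left.
  by apply: leq_mul => //; lia.
have low k j : (j + k = m)%N -> ('C(m.*2, j) <= 'C(m.*2, m))%N.
  elim: k j => [|k IH] j; first by rewrite addn0 => ->.
  by move=> jk; apply: (leq_trans (up j _)); [lia|apply: IH; lia].
have [im|mi] := leqP i m; first by apply: (low (m - i)%N); lia.
have [i2|i2] := leqP i m.*2; last by rewrite bin_small.
by rewrite -bin_sub//; apply: (low (i - m)%N); lia.
Qed.

Lemma central_bin_le m : ('C(m.*2, m) ^ 2 * m.*2.+1 <= 16 ^ m)%N.
Proof.
elim: m => [//|m IH].
have h : (m.+1 * 'C(m.+1.*2, m.+1) = 2 * m.*2.+1 * 'C(m.*2, m))%N.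
  have h1 := mul_bin_diag m.*2.+2 m.
  have h2 : 'C(m.*2.+1, m) = 'C(m.*2.+1, m.+1).
    by rewrite -[RHS]bin_sub; [congr 'C(_, _); lia|lia].
  have h3 := mul_bin_diag m.*2.+1 m.
  rewrite doubleS -h1 /= h2; move: h3 => /=.
  by set X := 'C(_, m.+1); set Y := 'C(m.*2, m); rewrite -muln2; nia.
rewrite -(leq_pmul2l (_ : 0 < m.+1 ^ 2)%N) ?expn_gt0//.
rewrite mulnA -expnMn h expnMn (expnS 16).
have : ((2 * m.*2.+1) ^ 2 * (m.+1.*2.+1) <= 16 * m.+1 ^ 2 * m.*2.+1)%N.
  by rewrite -!muln2; nia.
move: IH; set c := ('C(_, _) ^ 2)%N; set a := ((2 * _) ^ 2)%N.
set b := m.+1.*2.+1; set e := m.*2.+1; set f := (m.+1 ^ 2)%N => h1 h2.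
have h3 : (c * (a * b) <= c * (16 * f * e))%N by rewrite leq_mul2l h2 orbT.
have h4 : (16 * f * (c * e) <= 16 * f * 16 ^ m)%N by rewrite leq_mul2l h1 orbT.
rewrite [(a * c)%N]mulnC -mulnA; apply: (leq_trans h3).
rewrite mulnC -mulnA [(e * c)%N]mulnC; apply: (leq_trans h4).
by rewrite [(16 * f)%N]mulnC -mulnA.
Qed.

(** The largest atom of the fair binomial law is the central one when a is even;
   Pascal's rule reduces the odd case to the even one. *)
Lemma bin_sqr_le a i : ('C(a, i) ^ 2 * a.+1 <= 2 * 4 ^ a)%N.
Proof.
rewrite -(odd_double_half a); set m := a./2.
have c := central_bin_le m.
have e16 : (4 ^ m.*2 = 16 ^ m)%N by rewrite -mul2n expnM.
case: (odd a); rewrite ?add0n ?add1n.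
  have h : ('C(m.*2.+1, i) <= 2 * 'C(m.*2, m))%N.
    case: i => [|i]; first by rewrite bin0 muln_gt0/= bin_gt0 -addnn leq_addr.
    by rewrite binS mulSn mul1n leq_add// bin_le_central.
  rewrite (expnS 4) e16.
  have h2 : ('C(m.*2.+1, i) ^ 2 <= 4 * 'C(m.*2, m) ^ 2)%N.
    by rewrite -[4%N]/(2 ^ 2)%N -expnMn leq_exp2r.
  apply: leq_trans (leq_mul h2 (leqnn _)) _.
  rewrite -mulnA [leqRHS]mulnCA leq_mul2l /=.
  apply: leq_trans (leq_mul (leqnn 2) c); rewrite [leqRHS]mulnCA leq_mul2l.
  by apply/orP; right; lia.
rewrite e16; apply: leq_trans (leq_trans c _); last by rewrite leq_pmull.
by rewrite leq_mul2r leq_exp2r// bin_le_central orbT.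
Qed.

Section two_step_averages.
Context {R : realType} {d : nat} (x0 : lattice d).
Implicit Types (f g : lattice d -> R) (x z : lattice d).

(** The mean of f after one step, from x, that is x0 or z with equal
   probabilities. *)
Definition average z f x : R := (f (x + x0) + f (x + z)) / 2.

Lemma averageC z w f : average z (average w f) = average w (average z f).
Proof.
apply/funext => x; rewrite /average -!addrA [x0 + w]addrC [z + x0]addrC.
by rewrite [z + w]addrC; ring.
Qed.

Lemma iter_averageC b z w f :
  average z (iter b (average w) f) = iter b (average w) (average z f).
Proof. by elim: b => //= b IH; rewrite averageC IH. Qed.

Lemma average_ge0 z f : (forall x, 0 <= f x) -> forall x, 0 <= average z f x.
Proof. by move=> f0 x; rewrite divr_ge0// addr_ge0. Qed.

Lemma iter_average_ge0 a z f :
  (forall x, 0 <= f x) -> forall x, 0 <= iter a (average z) f x.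
Proof. by move=> f0; elim: a => //= a IH; exact: average_ge0. Qed.

Lemma iter_averageE a z f x : iter a (average z) f x =
  \sum_(i < a.+1) 'C(a, i)%:R / 2 ^+ a * f (x + x0 *+ a + (z - x0) *+ i).
Proof.
elim: a x => [|a IH] x.
  by rewrite big_ord1 /= bin0 expr0 divr1 mul1r !mulr0n !addr0.
rewrite iterS /average !IH.
pose G i := f (x + x0 *+ a.+1 + (z - x0) *+ i).
have e0 (i : 'I_a.+1) : f (x + x0 + x0 *+ a + (z - x0) *+ i) = G i.
  by rewrite /G mulrS !addrA.
have e1 (i : 'I_a.+1) : f (x + z + x0 *+ a + (z - x0) *+ i) = G i.+1.
  rewrite /G (mulrS x0) (mulrS (z - x0)) -[in RHS]addrA [in RHS]addrACA.
  by rewrite [x0 + (z - x0)]addrC subrK !addrA.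
under eq_bigr do rewrite e0.
under [X in (_ + X) / _]eq_bigr do rewrite e1.
transitivity ((\sum_(i < a.+2) 'C(a, i)%:R * G i +
    \sum_(i < a.+1) 'C(a, i)%:R * G i.+1) / 2 ^+ a.+1).
  rewrite [X in _ = (X + _) / _]big_ord_recr/= bin_small// mul0r addr0.
  rewrite !mulrDl !mulr_suml; congr (_ + _); apply: eq_bigr => i _;
    by rewrite exprS; field.
rewrite big_ord_recl /= bin0 -addrA -big_split/= mulrDl [RHS]big_ord_recl/= bin0.
congr (_ + _); first by rewrite mulrAC.
rewrite mulr_suml; apply: eq_bigr => i _.
by rewrite /bump/= add1n binS natrD -mulrDl mulrAC.
Qed.

(** Bound each binomial weight by the largest one. *)
Lemma iter_average_le a z f x : (forall y, 0 <= f y) ->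
  iter a (average z) f x <= Num.sqrt (2 / a.+1%:R) *
    \sum_(i < a.+1) f (x + x0 *+ a + (z - x0) *+ i).
Proof.
move=> f0; rewrite iter_averageE mulr_sumr; apply: ler_sum => i _.
apply: ler_wpM2r => //.
have b0 : 0 <= 'C(a, i)%:R / 2 ^+ a :> R by rewrite divr_ge0// exprn_ge0.
rewrite -[leLHS]ger0_norm// -sqrtr_sqr ler_wsqrtr//.
rewrite expr_div_n ler_pdivlMr ?ltr0n// mulrAC ler_pdivrMr ?exprn_gt0//.
rewrite -exprM mulnC exprM -!natrX -!natrM ler_nat.
exact: bin_sqr_le.
Qed.

(** Linear independence, for nonnegative integer coefficients. *)
Definition noncollinear (e1 e2 : lattice d) := forall i j i' j' : nat,
  e1 *+ i + e2 *+ j = e1 *+ i' + e2 *+ j' -> i = i' /\ j = j'.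

(** The end point determines the numbers of steps z1 and z2, so at most one pair
   of them leads to the origin; its probability is at most the product of the
   two largest binomial weights, and the square root of a product is at most
   the mean of its factors. *)
Lemma iter_average_origin_le a b z1 z2 x : noncollinear (z1 - x0) (z2 - x0) ->
  iter a (average z1) (iter b (average z2) (fun y => (y == 0)%:R)) x <=
  a.+1%:R^-1 + b.+1%:R^-1.
Proof.
move=> nc; set f0 := fun y => _.
have f00 y : 0 <= f0 y by rewrite ler0n.
set ba := Num.sqrt (2 / a.+1%:R : R); set bb := Num.sqrt (2 / b.+1%:R : R).
have ba0 : 0 <= ba by rewrite sqrtr_ge0.
have bb0 : 0 <= bb by rewrite sqrtr_ge0.
apply: (@le_trans _ _ (ba * (bb * 1))).
  apply: le_trans (iter_average_le a z1 x _) _.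
    exact: iter_average_ge0.
  rewrite ler_wpM2l//.
  apply: (@le_trans _ _ (\sum_(i < a.+1) (bb * \sum_(j < b.+1)
      f0 (x + x0 *+ a + (z1 - x0) *+ i + x0 *+ b + (z2 - x0) *+ j)))).
    by apply: ler_sum => i _; exact: iter_average_le.
  rewrite -mulr_sumr ler_wpM2l// pair_big/=.
  pose c := x + x0 *+ a + x0 *+ b.
  have fE (p : 'I_a.+1 * 'I_b.+1) :
      f0 (x + x0 *+ a + (z1 - x0) *+ p.1 + x0 *+ b + (z2 - x0) *+ p.2) =
      (c + ((z1 - x0) *+ p.1 + (z2 - x0) *+ p.2) == 0)%:R.
    by rewrite /f0 /c addrA (addrAC (x + _) (_ *+ p.1)).
  under eq_bigr do rewrite fE.
  have [p /eqP pP|h] := pickP (fun p : 'I_a.+1 * 'I_b.+1 =>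
      c + ((z1 - x0) *+ p.1 + (z2 - x0) *+ p.2) == 0); last first.
    by rewrite big1// => p _; rewrite h.
  rewrite (bigD1 p)//= pP eqxx big1 ?addr0// => q qp.
  case: eqP => // qP; case/negP: qp; apply/eqP.
  have /nc[] : (z1 - x0) *+ q.1 + (z2 - x0) *+ q.2 =
      (z1 - x0) *+ p.1 + (z2 - x0) *+ p.2.
    by apply: (addrI c); rewrite qP pP.
  by case: q p {pP qP} => q1 q2 [p1 p2] /= /val_inj -> /val_inj ->.
have ha : ba ^+ 2 = 2 / a.+1%:R by rewrite sqr_sqrtr// divr_ge0.
have hb : bb ^+ 2 = 2 / b.+1%:R by rewrite sqr_sqrtr// divr_ge0.
rewrite mulr1; have := sqr_ge0 (ba - bb); rewrite sqrrB ha hb.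
by move: (ba * bb) (a.+1%:R^-1) (b.+1%:R^-1) => u v w; lra.
Qed.

End two_step_averages.

(** The mean of 1 / (a + 1 + X) for a binomial variable X with parameters k
   and p. *)
Fixpoint binomial_inverse_mean {R : realType} (p : R) k a : R :=
  if k is k'.+1 then p * binomial_inverse_mean p k' a.+1 +
    (1 - p) * binomial_inverse_mean p k' a
  else a.+1%:R^-1.

Lemma binomial_inverse_mean_le {R : realType} (p : R) k : 0 < p ->
  p <= 1 -> binomial_inverse_mean p k 0 <= (p * k.+1%:R)^-1.
Proof.
move=> p0 p1; set t := binomial_inverse_mean p.
have tS k' a : t k'.+1 a = p * t k' a.+1 + (1 - p) * t k' a by [].
(* for a > 0 this is an equality: integrate the derivative of
   z^a (1 - p + p z)^(k+1), as t k a is the integral of z^a (1 - p + p z)^k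
   over [0, 1] *)
have h a : p * k.+1%:R * t k a + a%:R * t k.+1 a.-1 <= 1.
  elim: k a => [|k' IH] a.
    rewrite tS /t /=; case: a => [|a] /=; first by rewrite mul0r invr1; lra.
    have n0 : a.+1%:R != 0 :> R by rewrite pnatr_eq0.
    have n1 : a.+2%:R != 0 :> R by rewrite pnatr_eq0.
    rewrite le_eqVlt; apply/orP; left; apply/eqP.
    move: n0 n1; rewrite -[a.+2%:R]natr1.
    by move: a.+1%:R => n n0 n1; field; rewrite ?n0 ?n1.
  have e : p * k'.+2%:R * t k'.+1 a + a%:R * t k'.+2 a.-1 =
      p * (p * k'.+1%:R * t k' a.+1 + a.+1%:R * t k'.+1 a) +
      (1 - p) * (p * k'.+1%:R * t k' a + a%:R * t k'.+1 a.-1).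
    case: a => [|a]; rewrite ?[t k'.+2 _]tS [t k'.+1 _]tS -?[k'.+2%:R]natr1
      -?[a.+2%:R]natr1 /=; ring.
  rewrite e.
  have := IH a; have := IH a.+1; rewrite /= => h1 h2.
  by nra.
have := h 0%N; rewrite mul0r addr0 => h0.
have pk : 0 < p * k.+1%:R by rewrite mulr_gt0.
by rewrite -[leRHS]mul1r ler_pdivlMr// mulrC.
Qed.

Section planar_green.
Context {R : realType} {d : nat}.
Notation steps := (product_space (lattice d) nat).
Context (r : probability (lattice d) R) (nu : probability steps R).
Hypothesis rnu : iid_law r nu.
Context (x0 x1 x2 : lattice d) (p : R).
Hypotheses (p0 : 0 < p) (p2 : 2 * p <= 1).
Hypotheses (rx0 : (p%:E <= r [set x0])%E) (rx1 : ((p / 2)%:E <= r [set x1])%E)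
  (rx2 : ((p / 2)%:E <= r [set x2])%E).
Hypothesis nc : noncollinear (x1 - x0) (x2 - x0).

Lemma noncollinear_neq : [/\ x1 != x0, x2 != x0 & x1 != x2].
Proof.
split; apply/eqP => e.
- suff /nc[] : (x1 - x0) *+ 1 + (x2 - x0) *+ 0 = (x1 - x0) *+ 0 + (x2 - x0) *+ 0.
    by [].
  by rewrite e subrr !mul0rn.
- suff /nc[] : (x1 - x0) *+ 0 + (x2 - x0) *+ 1 = (x1 - x0) *+ 0 + (x2 - x0) *+ 0.
    by [].
  by rewrite e subrr !mul0rn.
- suff /nc[] : (x1 - x0) *+ 1 + (x2 - x0) *+ 0 = (x1 - x0) *+ 0 + (x2 - x0) *+ 1.
    by [].
  by rewrite e !mulr0n !mulr1n addr0 add0r.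
Qed.

(** The step law dominates p times the uniform law on x0 and x1 plus p times the
   uniform law on x0 and x2; on the rest of its mass, 1 - 2 p, f is at most s. *)
Lemma integral_step_le (f g : lattice d -> R) (s : R) (x : lattice d) :
  (forall y, 0 <= f y) -> (forall y, f y <= s) ->
  ((g x)%:E = \int[r]_t (f (x + t))%:E)%E ->
  g x <= (1 - 2 * p) * s + p * average x0 x1 f x + p * average x0 x2 f x.
Proof.
move=> f0 fs gE.
have [n10 n20 n12] := noncollinear_neq.
have mlat (h : lattice d -> \bar R) : measurable_fun setT h.
  exact: measurable_lattice_fun.
pose m (z : lattice d) := fine (r [set z]).
have mE z : (r [set z] = (m z)%:E)%E by rewrite fineK// fin_num_measure.
have Ih z (c : R) : 0 <= c ->
    (\int[r]_t (c * (t == z)%:R)%:E = (c * m z)%:E)%E.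
  move=> c0; under eq_integral do rewrite EFinM.
  rewrite ge0_integralZl//.
  transitivity (c%:E * \int[r]_t (\1_[set z] t)%:E)%E.
    congr (_ * _)%E; apply: eq_integral => t _; rewrite indicE.
    by congr ((_ : bool)%:R%:E); apply/eqP/idP; rewrite inE.
  by rewrite integral_indic ?setIT// EFinM; congr (_ * _)%E; exact: mE.
have s0 y : 0 <= s - f y by rewrite subr_ge0.
have key : (\int[r]_t ((f (x + t))%:E +
    ((((s - f (x + x0)) * (t == x0)%:R)%:E +
     ((s - f (x + x1)) * (t == x1)%:R)%:E) +
    ((s - f (x + x2)) * (t == x2)%:R)%:E)) <= s%:E)%E.
  rewrite -[leRHS](integral_prob_cst r); apply: ge0_le_integral => //.
    by move=> t _; rewrite !adde_ge0 ?lee_fin// ?mulr_ge0.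
  move=> t _; rewrite -!EFinD lee_fin.
  have [->|t0] := eqVneq t x0.
    rewrite (eq_sym x0) (negbTE n10) (eq_sym x0) (negbTE n20) !mulr0 !addr0 mulr1.
    by rewrite addrC subrK.
  have [->|t1] := eqVneq t x1.
    by rewrite (negbTE n12) !mulr0 !addr0 add0r mulr1 addrC subrK.
  have [->|t2] := eqVneq t x2; first by rewrite !mulr0 !add0r mulr1 addrC subrK.
  by rewrite !mulr0 !addr0.
move: key; rewrite ge0_integralD//; last 2 first.
- by move=> t _; rewrite lee_fin.
- by move=> t _; rewrite !adde_ge0 ?lee_fin ?mulr_ge0.
rewrite ge0_integralD//; last 2 first.
- by move=> t _; rewrite adde_ge0 ?lee_fin ?mulr_ge0.
- by move=> t _; rewrite lee_fin mulr_ge0.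
rewrite ge0_integralD//; last 2 first.
- by move=> t _; rewrite lee_fin mulr_ge0.
- by move=> t _; rewrite lee_fin mulr_ge0.
rewrite !Ih// -gE -!EFinD lee_fin /average.
move: rx0 rx1 rx2; rewrite !mE !lee_fin => h0 h1 h2.
have k0 := ler_wpM2l (s0 (x + x0)) h0.
have k1 := ler_wpM2l (s0 (x + x1)) h1.
have k2 := ler_wpM2l (s0 (x + x2)) h2.
move: k0 k1 k2; set u0 := m x0; set u1 := m x1; set u2 := m x2.
move: (f (x + x0)) (f (x + x1)) (f (x + x2)) => v0 v1 v2.
have -> : (1 - 2 * p) * s + p * ((v0 + v1) / 2) + p * ((v0 + v2) / 2) =
    s - (s - v0) * p - (s - v1) * (p / 2) - (s - v2) * (p / 2) by field.
move: ((s - v0) * p) ((s - v0) * u0) ((s - v1) * (p / 2)) ((s - v1) * u1).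
move: ((s - v2) * (p / 2)) ((s - v2) * u2) => a b a' b' a'' b''.
by lra.
Qed.

Definition hit_prob k x : R := fine (\int[nu]_y (hits x k y : R)%:E)%E.

Lemma hit_probE k x : (\int[nu]_y (hits x k y : R)%:E = (hit_prob k x)%:E)%E.
Proof.
rewrite fineK// ge0_fin_numE; last by apply: integral_ge0 => y _; rewrite lee_fin.
apply: (@le_lt_trans _ _ 1%E); last by rewrite ltry.
rewrite -[leRHS](integral_prob_cst nu); apply: ge0_le_integral => //.
- by move=> y _; rewrite lee_fin.
- exact: measurable_hits.
- by move=> y _; rewrite lee_fin /hits; case: eqP.
Qed.

Lemma hit_prob_ge0 k x : 0 <= hit_prob k x.
Proof. by apply: fine_ge0; apply: integral_ge0 => y _; rewrite lee_fin. Qed.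

Lemma hit_prob0 x : hit_prob 0 x = (x == 0)%:R.
Proof.
apply: EFin_inj; rewrite -hit_probE.
under eq_integral do rewrite /hits position0 addr0.
exact: (integral_prob_cst nu).
Qed.

Lemma hit_probS k x :
  ((hit_prob k.+1 x)%:E = \int[r]_t (hit_prob k (x + t))%:E)%E.
Proof.
rewrite -hit_probE (integral_scons rnu)//; [|exact: measurable_hits|
  by move=> y; rewrite lee_fin].
by apply: eq_integral => t _; under eq_integral do rewrite hitsS; rewrite hit_probE.
Qed.

Lemma iter_average_integral a z (f g : lattice d -> R) :
  (forall y, 0 <= f y) ->
  (forall x, (g x)%:E = \int[r]_t (f (x + t))%:E)%E ->
  forall x, ((iter a (average x0 z) g x)%:E =
    \int[r]_t (iter a (average x0 z) f (x + t)%R)%:E)%E.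
Proof.
move=> f0 gE; elim: a => [|a IH] x //=.
have F0 := iter_average_ge0 x0 a z f0.
rewrite /average EFinM EFinD !IH -ge0_integralD//; last 2 first.
- by move=> t _; rewrite lee_fin.
- by move=> t _; rewrite lee_fin.
rewrite muleC -ge0_integralZl//; last by move=> t _; rewrite adde_ge0 ?lee_fin.
apply: eq_integral => t _; rewrite -EFinD -EFinM mulrC.
by rewrite !(addrAC _ _ t).
Qed.

(** Induction on k: with probability p a step is a fair choice between x0 and x1,
   with probability p a fair choice between x0 and x2, and otherwise it does
   not increase the supremum. The first two cases increase a or b by one, and
   the bound is a sum of a function of a and a function of b, each of which
   follows the recursion of binomial_inverse_mean. *)
Lemma iter_average_hit_prob_le k a b x :
  iter a (average x0 x1) (iter b (average x0 x2) (hit_prob k)) x <=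
  binomial_inverse_mean p k a + binomial_inverse_mean p k b.
Proof.
elim: k a b x => [|k IH] a b x.
  have -> : hit_prob 0 = fun y => (y == 0)%:R.
    by apply/funext => y; rewrite hit_prob0.
  exact: iter_average_origin_le.
pose f := iter a (average x0 x1) (iter b (average x0 x2) (hit_prob k)).
have f0 y : 0 <= f y.
  by do 2 apply: iter_average_ge0 => ?; exact: hit_prob_ge0.
have fs y := IH a b y.
have h := @integral_step_le f
  (iter a (average x0 x1) (iter b (average x0 x2) (hit_prob k.+1))) _ x f0 fs.
have {}h := h (iter_average_integral _ _ (iter_average_ge0 x0 b x2 (hit_prob_ge0 k))
  (iter_average_integral _ _ (hit_prob_ge0 k) (hit_probS k)) x).
apply: (le_trans h).
have i1 : average x0 x1 f x <=
    binomial_inverse_mean p k a.+1 + binomial_inverse_mean p k b.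
  exact: (IH a.+1 b x).
have i2 : average x0 x2 f x <=
    binomial_inverse_mean p k a + binomial_inverse_mean p k b.+1.
  by rewrite /f iter_averageC; exact: (IH a b.+1 x).
have j1 := ler_wpM2l (ltW p0) i1.
have j2 := ler_wpM2l (ltW p0) i2.
rewrite /=; move: j1 j2.
move: (binomial_inverse_mean p k a) (binomial_inverse_mean p k b)
  (binomial_inverse_mean p k a.+1) (binomial_inverse_mean p k b.+1).
move: (p * average x0 x1 f x) (p * average x0 x2 f x) => u v ta tb ta' tb'.
have -> : p * ta' + (1 - p) * ta + (p * tb' + (1 - p) * tb) =
  (1 - 2 * p) * (ta + tb) + p * (ta' + tb) + p * (ta + tb') by ring.
by move: (_ * (ta + tb)) (_ * (ta' + tb)) (_ * (ta + tb')) => w w' w''; lra.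
Qed.

Lemma return_prob_le k : return_prob nu k <= 2 / p * k.+1%:R^-1.
Proof.
have p1 : p <= 1 by move: p0 p2; lra.
have -> : return_prob nu k = hit_prob k 0.
  by apply: EFin_inj; rewrite -hit_probE integral_hits0.
apply: (le_trans (iter_average_hit_prob_le k 0 0 0)).
have := binomial_inverse_mean_le k p0 p1; rewrite invfM -mulrA.
by move: (p^-1 * _) (binomial_inverse_mean _ _ _) => u v; lra.
Qed.

Lemma sum_inv_le_ln n : (0 < n)%N ->
  \sum_(k < n) k.+1%:R^-1 <= 1 + ln n%:R :> R.
Proof.
elim: n => // -[_ _|n IH _].
  by rewrite big_ord1 invr1 ln1 addr0.
rewrite big_ord_recr/=; apply: (le_trans (lerD (IH isT) (lexx _))).
rewrite -addrA lerD2l; set a := n.+1%:R : R.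
have a0 : 0 < a by rewrite ltr0n.
have b0 : 0 < n.+2%:R :> R by rewrite ltr0n.
have := @le_ln1Dx R (- n.+2%:R^-1).
have -> : 1 + - n.+2%:R^-1 = a / n.+2%:R :> R.
  by rewrite -natr1 -/a; field; rewrite gt_eqF// addr_gt0.
rewrite ln_div ?posrE// => h.
have : -1 < - n.+2%:R^-1 :> R by rewrite ltrN2 invf_lt1// ltr1n.
by move=> {}/h; move: (ln a) (ln n.+2%:R) (n.+2%:R^-1) => u v w; lra.
Qed.

Lemma planar_green_le :
  exists2 C : R, 0 < C & forall n, (0 < n)%N -> green nu n <= C * (1 + ln n%:R).
Proof.
exists (2 / p) => [|n n0]; first by rewrite divr_gt0.
apply: (@le_trans _ _ (\sum_(k < n) (2 / p * k.+1%:R^-1))).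
  by apply: ler_sum => k _; exact: return_prob_le.
rewrite -mulr_sumr ler_wpM2l ?sum_inv_le_ln//.
by rewrite divr_ge0// ltW.
Qed.

End planar_green.

Definition cross (e1 e2 : lattice 2) : int :=
  (e1 : 'rV[int]_2) 0 0 * (e2 : 'rV[int]_2) 0 1 -
  (e1 : 'rV[int]_2) 0 1 * (e2 : 'rV[int]_2) 0 0.

Lemma row_combinationE n (u v : 'rV[int]_n) (a b : nat) k :
  (u *+ a + v *+ b) 0 k = u 0 k * a%:Z + v 0 k * b%:Z.
Proof.
by rewrite mxE !mulmxnE -[u 0 k *+ a]mulr_natr -[v 0 k *+ b]mulr_natr !natz.
Qed.

Lemma row_subE n (u v : lattice n) (k : 'I_n) :
  ((u - v : lattice n) : 'rV[int]_n) 0 k =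
  (u : 'rV[int]_n) 0 k - (v : 'rV[int]_n) 0 k.
Proof.
rewrite -[LHS]/(((u : 'rV[int]_n) - (v : 'rV[int]_n)) 0 k).
by rewrite !mxE.
Qed.

Lemma cross_noncollinear (e1 e2 : lattice 2) :
  cross e1 e2 != 0 -> noncollinear e1 e2.
Proof.
move=> c0 i j i' j' e.
have E k : (e1 : 'rV[int]_2) 0 k * (i%:Z - i'%:Z) +
    (e2 : 'rV[int]_2) 0 k * (j%:Z - j'%:Z) = 0.
  have L (a b : nat) : ((e1 *+ a + e2 *+ b : lattice 2) : 'rV[int]_2) 0 k =
      (e1 : 'rV[int]_2) 0 k * a%:Z + (e2 : 'rV[int]_2) 0 k * b%:Z.
    exact: row_combinationE.
  have := congr1 (fun f : lattice 2 => (f : 'rV[int]_2) 0 k) e.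
  rewrite !L => h; rewrite !mulrBr addrACA h -opprD.
  by rewrite subrr.
have E0 := E 0; have E1 := E 1; move: c0; rewrite /cross.
move: E0 E1; move: ((e1 : 'rV[int]_2) 0 0) ((e1 : 'rV[int]_2) 0 1).
move: ((e2 : 'rV[int]_2) 0 0) ((e2 : 'rV[int]_2) 0 1) => c d a b E0 E1 D0.
have hi : (a * d - b * c) * (i%:Z - i'%:Z) = 0.
  transitivity ((a * (i%:Z - i'%:Z) + c * (j%:Z - j'%:Z)) * d -
    (b * (i%:Z - i'%:Z) + d * (j%:Z - j'%:Z)) * c); first by ring.
  by rewrite E0 E1 !mul0r subrr.
have hj : (a * d - b * c) * (j%:Z - j'%:Z) = 0.
  transitivity ((b * (i%:Z - i'%:Z) + d * (j%:Z - j'%:Z)) * a -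
    (a * (i%:Z - i'%:Z) + c * (j%:Z - j'%:Z)) * b); first by ring.
  by rewrite E0 E1 !mul0r subrr.
move/eqP: hi; rewrite mulf_eq0 (negbTE D0)/= subr_eq0 => /eqP[->].
by move/eqP: hj; rewrite mulf_eq0 (negbTE D0)/= subr_eq0 => /eqP[->].
Qed.

Section support_of_planar_step.
Context {dT : measure_display} {T : measurableType dT} {R : realType}
  (P : probability T R).

(** The lattice is countable, so the points that are not atoms together have
   probability zero. *)
Lemma ae_atom (n : nat) (X : {RV P >-> lattice n}) (Q : lattice n -> Prop) :
  (forall x, (0 < P (X @^-1` [set x]))%E -> Q x) -> {ae P, forall w, Q (X w)}.
Proof.
move=> hQ.
pose F k : set T :=
  if (choice.unpickle k : option (lattice n)) is Some x then
    if pselect (0 < P (X @^-1` [set x]))%E then set0 else X @^-1` [set x]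
  else set0.
apply: (@negligibleS _ _ _ _ (\bigcup_k F k)).
  move=> w /= nQ; exists (choice.pickle (X w)) => //; rewrite /F choice.pickleK.
  by case: (pselect (0 < P (X @^-1` [set X w]))%E) => h /=; first by move: (hQ _ h).
apply: negligible_bigcup => k; rewrite /F.
case: (choice.unpickle k : option (lattice n)) => [x|]; last exact: negligible_set0.
case: (pselect (0 < P (X @^-1` [set x]))%E) => h /=; first exact: negligible_set0.
have mX : measurable (X @^-1` [set x]).
  by rewrite -[X in measurable X]setTI; exact: measurable_funP.
apply/negligibleP => //; apply/eqP; rewrite eq_le measure_ge0 andbT leNgt.
exact/negP.
Qed.

Lemma covariance_ae_cst (W Y : T -> R) (c : R) :
  measurable_fun setT W -> measurable_fun setT Y ->
  {ae P, forall w, W w = c} -> covariance P W Y = 0%E.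
Proof.
move=> mW mY Wc.
have EW : ('E_P[W] = c%:E)%E.
  rewrite -(expectation_cst P c) unlock; apply: ae_eq_integral => //.
  - exact/measurable_EFinP.
  - by apply/measurable_EFinP; exact: measurable_cst.
  - by move: Wc; apply: filterS => w /= ->.
rewrite unlock EW /=.
transitivity ('E_P[cst 0%R])%E; last exact: expectation_cst.
rewrite unlock.
apply: ae_eq_integral => //.
- apply/measurable_EFinP; apply: measurable_funM.
    exact: measurable_funB.
  exact: measurable_funB.
- by apply/measurable_EFinP; exact: measurable_cst.
- by move: Wc; apply: filterS => w /= Ww _; rewrite !fctE /= Ww subrr mul0r.
Qed.

Lemma measurable_coord n (X : {RV P >-> lattice n}) (i : 'I_n) :
  measurable_fun setT (coord i X : T -> R).
Proof.
apply: (measurableT_comp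
  (f := fun x : lattice n => ((x : 'rV[int]_n) 0 i)%:~R : R)) => //.
Qed.

(** If all atoms lay on a line with normal vector v, then v would be in the
   kernel of the covariance matrix. *)
Lemma nonsingular_covariance_support (X : {RV P >-> lattice 2}) :
  finite_covariance P X -> covariance_mx P X \in unitmx ->
  exists x0 x1 x2, [/\ (0 < P (X @^-1` [set x0]))%E,
    (0 < P (X @^-1` [set x1]))%E, (0 < P (X @^-1` [set x2]))%E &
    noncollinear (x1 - x0) (x2 - x0)].
Proof.
move=> fX uX.
pose atom x := (0 < P (X @^-1` [set x]))%E.
have line (v : 'rV[R]_2) (c : R) : v != 0 ->
    ~ (forall x : lattice 2, atom x ->
      v 0 0 * ((x : 'rV[int]_2) 0 0)%:~R + v 0 1 * ((x : 'rV[int]_2) 0 1)%:~R = c).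
  move=> v0 h.
  have aeW : {ae P, forall w, v 0 0 * coord 0 X w + v 0 1 * coord 1 X w = c}.
    by apply: (@ae_atom 2 X (fun x => v 0 0 * ((x : 'rV[int]_2) 0 0)%:~R +
      v 0 1 * ((x : 'rV[int]_2) 0 1)%:~R = c)).
  have mc i := measurable_coord X i.
  have covW j : covariance P ((v 0 0 \o* coord 0 X) \+ (v 0 1 \o* coord 1 X))%R
      (coord j X) = 0%E.
    apply: (covariance_ae_cst (c := c)) => //.
      by apply: measurable_funD; exact: measurable_funM.
    by move: aeW; apply: filterS => w /= <-; rewrite ![_ * v _ _]mulrC.
  have Pfin : P setT \is a fin_num := fin_num_measure P _ measurableT.
  have f1 i : (coord i X : T -> R) \in Lfun P 1 := Lfun_subset12 Pfin (fX i).
  have f2 i j := Lfun2_mul_Lfun1 (fX i) (fX j).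
  have s2 (a : R) i : (a \o* (coord i X : T -> R))%R \in Lfun P 2%:E.
    by apply: Lfun_scale; [rewrite ler1n|exact: fX].
  have fin i j : covariance P (coord i X) (coord j X) \is a fin_num.
    exact: (covariance_fin_num (f1 i) (f1 j) (f2 i j)).
  have vC : v *m covariance_mx P X = 0.
    apply/rowP => j; rewrite !mxE big_ord_recl big_ord1 !mxE.
    have -> : lift ord0 ord0 = 1 :> 'I_2 by exact: val_inj.
    have := covW j; rewrite (covarianceDl (s2 _ _) (s2 _ _) (fX j)).
    rewrite !(covarianceZl _ (f1 _) (f1 j) (f2 _ j)).
    rewrite -(fineK (fin 0 j)) -(fineK (fin 1 j)) -!EFinM -EFinD => -[vh]; exact: vh.
  move/eqP: v0; apply.
  by rewrite -(mulmxK uX v) vC mul0mx.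
have [x0 a0] : exists x0, atom x0.
  apply: contrapT => /forallNP h.
  apply: (line (const_mx 1) 0) => [|x /h//].
  by apply/eqP => /rowP/(_ 0); rewrite !mxE => /eqP; rewrite oner_eq0.
apply: contrapT => nope.
have cross0 x1 x2 : atom x1 -> atom x2 -> cross (x1 - x0) (x2 - x0) = 0.
  move=> a1 a2; apply/eqP/negPn/negP => /cross_noncollinear nc.
  by apply: nope; exists x0, x1, x2; split.
have [[x1 [a1 n1]]|h] := pselect (exists x1, atom x1 /\ x1 <> x0).
  pose e : 'rV[int]_2 := x1 - x0.
  (* v is normal to x1 - x0 *)
  pose v : 'rV[R]_2 := \row_i (if i == 0 then - (e 0 1)%:~R else (e 0 0)%:~R).
  apply: (line v (v 0 0 * ((x0 : 'rV[int]_2) 0 0)%:~R +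
      v 0 1 * ((x0 : 'rV[int]_2) 0 1)%:~R)).
    apply/eqP => /rowP v0; apply: n1; apply/eqP; rewrite -subr_eq0; apply/eqP.
    have e1 : e 0 1 = 0.
      by have := v0 0; rewrite !mxE /= => /eqP; rewrite oppr_eq0 intr_eq0 => /eqP.
    have e0 : e 0 0 = 0.
      by have := v0 1; rewrite !mxE /= => /eqP; rewrite intr_eq0 => /eqP.
    apply: (_ : e = 0 :> 'rV[int]_2); apply/rowP => i; rewrite [RHS]mxE.
    have [->|->] : i = 0 \/ i = 1.
      by case: i => -[|[|//]] ?; [left|right]; exact: val_inj.
    - exact: e0.
    - exact: e1.
  move=> x2 a2; have := cross0 x1 x2 a1 a2; rewrite /cross -/e !row_subE.
  move=> /(congr1 (fun z : int => z%:~R : R)).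
  rewrite !mxE /= rmorph0 rmorphB !rmorphM !rmorphB /=.
  set p : R := (e 0 0)%:~R; set q : R := (e 0 1)%:~R.
  set b0 : R := ((x2 : 'rV[int]_2) 0 0)%:~R.
  set b1 : R := ((x2 : 'rV[int]_2) 0 1)%:~R.
  set c0 : R := ((x0 : 'rV[int]_2) 0 0)%:~R.
  set c1 : R := ((x0 : 'rV[int]_2) 0 1)%:~R.
  by move=> h; apply/eqP; rewrite -subr_eq0; apply/eqP; rewrite -[RHS]h; ring.
(* x0 is the only atom, so every v will do *)
apply: (line (const_mx 1) (((x0 : 'rV[int]_2) 0 0)%:~R +
    ((x0 : 'rV[int]_2) 0 1)%:~R)).
  by apply/eqP => /rowP/(_ 0); rewrite !mxE => /eqP; rewrite oner_eq0.
move=> x ax; have -> : x = x0 by apply: contrapT => n; apply: h; exists x.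
by rewrite !mxE !mul1r.
Qed.

End support_of_planar_step.

(** * From the mean maximum to the persistence probability *)

Section persistence_asymptotics.
Context {R : realType}.
Context (e a p : nat -> R) (C c : R).
Hypotheses (C0 : 0 < C) (c0 : 0 < c) (a0 : forall m, 0 <= a m)
  (e_0 : e 0%N = 0) (eS : forall m, e m.+1 = e m + a m)
  (a_noninc : forall m m', (m <= m')%N -> a m' <= a m)
  (e_ge : forall n, (0 < n)%N -> c * Num.sqrt n%:R <= e n)
  (e_le : forall n, (0 < n)%N ->
     e n <= (ln n%:R + 2) * Num.sqrt (2 * n%:R * (C * (1 + ln n%:R))))
  (p_le : forall m A, 1 <= A -> p m <= expR 1 * A * a m + expR (2 - A))
  (a_le : forall m A, 0 <= A -> a m <= A * p m + expR (2 - A)).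

(** The increments a of e are nonincreasing, so the mean slope of e before a
   point is at least, and after it at most, the slope at that point. *)
Lemma mean_ge_increment m k : k%:R * a (m + k) <= e (m + k) - e m.
Proof.
elim: k => [|k IH]; first by rewrite addn0 mul0r subrr.
rewrite addnS eS -natr1 mulrDl mul1r addrAC; apply: lerD; last exact: a_noninc.
apply: le_trans IH; rewrite ler_wpM2l//; exact: a_noninc.
Qed.

Lemma mean_le_increment m k : e (m + k) - e m <= k%:R * a m.
Proof.
elim: k => [|k IH]; first by rewrite addn0 mul0r subrr.
rewrite addnS eS -natr1 mulrDl mul1r addrAC; apply: lerD => //.
by apply: a_noninc; exact: leq_addr.
Qed.

Lemma e_le_log N : (0 < N)%N -> 2 <= ln (N%:R : R) ->
  e N <= 4 * Num.sqrt C * ln N%:R ^+ 2 * Num.sqrt N%:R.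
Proof.
move=> N0 L2; apply: (le_trans (e_le N0)); set L := ln N%:R in L2 *.
have N1 : 0 <= N%:R :> R by [].
have -> : 4 * Num.sqrt C * L ^+ 2 * Num.sqrt N%:R =
    (2 * L) * (2 * L * Num.sqrt C * Num.sqrt N%:R) by ring.
apply: ler_pM; rewrite ?sqrtr_ge0//; [lra|lra|].
have -> : 2 * L * Num.sqrt C * Num.sqrt N%:R =
    Num.sqrt ((2 * L) ^+ 2 * C * N%:R).
  have L0 : 0 <= 2 * L by lra.
  rewrite sqrtrM; last by rewrite mulr_ge0 ?sqr_ge0// ltW.
  by rewrite sqrtrM ?sqr_ge0// sqrtr_sqr ger0_norm.
apply: ler_wsqrtr.
have -> : 2 * N%:R * (C * (1 + L)) = 2 * (1 + L) * (C * N%:R) by ring.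
have -> : (2 * L) ^+ 2 * C * N%:R = (2 * L) ^+ 2 * (C * N%:R) by ring.
apply: ler_wpM2r; first by rewrite mulr_ge0// ltW.
by rewrite expr2; nra.
Qed.

Lemma expR_ge_pow (x : R) k : 0 <= x -> x ^+ k <= expR (x *+ k).
Proof.
move=> x0; rewrite -mulr_natl expRM_natl.
apply: lerXn2r; rewrite ?nnegrE ?expR_ge0//.
by apply: le_trans (expR_ge1Dx x); rewrite lerDr.
Qed.

(** The slope a m is at most e (m + 1) / (m + 1). *)
Lemma persistence_upper m : let L := ln (m.+1%:R : R) in
  2 <= L -> expR 1 * (4 * Num.sqrt C) + expR 2 <= L ->
  p m <= (Num.sqrt m.+1%:R)^-1 * L ^+ 5.
Proof.
move=> L L2 LK; set s := Num.sqrt m.+1%:R; set K := expR 1 * _ + _ in LK.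
have N0 : 0 < m.+1%:R :> R by rewrite ltr0n.
have s0 : 0 < s by rewrite sqrtr_gt0.
have ss : s * s = m.+1%:R by rewrite -expr2 sqr_sqrtr// ltW.
have s1 : 1 <= s by rewrite -sqrtr1 ler_wsqrtr// ler1n.
have eL := e_le_log (ltn0Sn m) L2.
have am : a m <= 4 * Num.sqrt C * L ^+ 2 / s.
  have h := mean_ge_increment 0 m; rewrite add0n e_0 subr0 in h.
  have : m.+1%:R * a m <= 4 * Num.sqrt C * L ^+ 2 * s.
    by apply: le_trans eL; rewrite eS -natr1 mulrDl mul1r lerD2r.
  move=> am'; rewrite ler_pdivlMr// -(ler_pM2r s0).
  by have -> : a m * s * s = m.+1%:R * a m by rewrite -ss; ring.
have L1 : 1 <= L by lra.
apply: (le_trans (p_le m L1)).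
have eE : expR (2 - L) = expR 2 / (s * s).
  by rewrite expRD expRN /L lnK ?posrE// ss.
rewrite eE.
have t1 : expR 1 * L * a m <= expR 1 * (4 * Num.sqrt C) * L ^+ 3 / s.
  have -> : expR 1 * (4 * Num.sqrt C) * L ^+ 3 / s =
      expR 1 * L * (4 * Num.sqrt C * L ^+ 2 / s).
    by rewrite (exprS L 2); field; rewrite gt_eqF.
  by rewrite ler_wpM2l// mulr_ge0 ?expR_ge0//; lra.
have t2 : expR 2 / (s * s) <= expR 2 * L ^+ 3 / s.
  rewrite -mulrA ler_pM2l ?expR_gt0// invfM -[leLHS]mulr1 -mulrA.
  rewrite [leRHS]mulrC ler_pM2l ?invr_gt0// mulr1.
  apply: (@le_trans _ _ 1); first by rewrite invf_le1.
  by rewrite exprn_ege1.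
apply: (le_trans (lerD t1 t2)).
have -> : expR 1 * (4 * Num.sqrt C) * L ^+ 3 / s + expR 2 * L ^+ 3 / s =
    s^-1 * (K * L ^+ 3).
  by rewrite /K; field; rewrite gt_eqF.
rewrite ler_pM2l ?invr_gt0//.
have -> : L ^+ 5 = (L * L) * L ^+ 3 by rewrite -expr2 -exprD.
rewrite ler_wpM2r ?exprn_ge0//; first by lra.
by apply: (le_trans LK); rewrite ler_peMl//; lra.
Qed.

(** Compare e at m + 1 and at M = (m + 1) q^2 with q of order L^3: the lower
   bound on e M exceeds twice the upper bound on e (m + 1), so that the slope a m
   is at least of order e M / M, which is (sqrt (m + 1) q)^(-1). *)
Lemma persistence_lower m : let L := ln (m.+1%:R : R) in
  2 <= L -> 8 * Num.sqrt C / c + 1 <= L -> 2 ^+ 12 / c <= L ->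
  2 ^+ 12 * (4 * expR 2) / c <= L ->
  (Num.sqrt m.+1%:R)^-1 * expR (- 5 * Num.sqrt L) <= p m.
Proof.
move=> L L2 LK LK1 LK2; set s := Num.sqrt m.+1%:R.
have N0 : 0 < m.+1%:R :> R by rewrite ltr0n.
have s0 : 0 < s by rewrite sqrtr_gt0.
have ss : s * s = m.+1%:R by rewrite -expr2 sqr_sqrtr// ltW.
have L0 : 0 < L by lra.
have L3 : 0 < L ^+ 3 by rewrite exprn_gt0.
have eL := e_le_log (ltn0Sn m) L2.
(* L^3 and not L^2: the upper bound on e (m + 1) carries a factor L^2, which q
   must exceed by an arbitrary constant factor *)
pose q := Num.truncn (L ^+ 3).
have /andP[q1 q2] : q%:R <= L ^+ 3 < q.+1%:R.
  by rewrite /q; apply: truncn_itv; exact: ltW.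
have qB : 8 * Num.sqrt C / c * L ^+ 2 <= q%:R.
  have : L ^+ 3 - 1 <= q%:R by move: q2; rewrite -natr1; lra.
  apply: le_trans; rewrite exprS.
  have : (8 * Num.sqrt C / c + 1) * L ^+ 2 <= L * L ^+ 2.
    by rewrite ler_wpM2r// sqr_ge0.
  have : 1 <= L ^+ 2 by rewrite exprn_ege1//; lra.
  by rewrite mulrDl mul1r; lra.
have q0 : 0 < q%:R :> R.
  rewrite ltr0n lt0n; apply/eqP => qz; move: q2; rewrite qz.
  by rewrite ltNge => /negP; apply; rewrite exprn_ege1//; lra.
have qn : (0 < q)%N by rewrite -(ltr0n R).
pose M := (m.+1 * (q * q))%N.
have Mm : (m.+1 <= M)%N by rewrite leq_pmulr// muln_gt0 qn.
have Mq : Num.sqrt M%:R = s * q%:R.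
  rewrite /M natrM natrM -expr2 sqrtrM; last exact: ltW.
  by rewrite sqrtr_sqr ger0_norm.
have M0 : (0 < M)%N by exact: leq_trans Mm.
have key : c * (s * q%:R) / 2 <= M%:R * a m.
  have h1 := e_ge M0; rewrite Mq in h1.
  have h2 := mean_le_increment m (M - m).
  rewrite subnKC in h2; last exact: ltnW.
  have h3 : (M - m)%:R * a m <= M%:R * a m.
    by rewrite ler_wpM2r// ler_nat leq_subr.
  have h4 : e m <= e m.+1 by rewrite eS lerDl.
  have h5 : 4 * Num.sqrt C * L ^+ 2 * s <= c * (s * q%:R) / 2.
    have : (8 * Num.sqrt C / c * L ^+ 2) * (c * s / 2) <= q%:R * (c * s / 2).
      by rewrite ler_wpM2r// divr_ge0// mulr_ge0// ltW.
    have -> : 8 * Num.sqrt C / c * L ^+ 2 * (c * s / 2) =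
      4 * Num.sqrt C * L ^+ 2 * s by field; rewrite gt_eqF.
    by move=> /le_trans; apply; rewrite le_eqVlt; apply/orP; left; apply/eqP; ring.
  have h6 := le_trans h4 (le_trans eL h5).
  move: h1 (le_trans h2 h3) h6; move: (c * (s * q%:R)) (M%:R * a m) => u v.
  by lra.
have am : c / (2 * s * L ^+ 3) <= a m.
  have h : c / (2 * s * q%:R) <= a m.
    rewrite ler_pdivrMr ?mulr_gt0//.
    rewrite -(ler_pM2l (_ : 0 < s * q%:R / 2)) ?divr_gt0 ?mulr_gt0//.
    have e1 : s * q%:R / 2 * c = c * (s * q%:R) / 2 by ring.
    have e2 : s * q%:R / 2 * (a m * (2 * s * q%:R)) = M%:R * a m.
      by rewrite /M natrM natrM -ss; field.
    by rewrite e1 e2.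
  apply: le_trans h; rewrite ler_pM2l//.
  by rewrite lef_pV2 ?posrE ?mulr_gt0// ler_pM2l// mulr_gt0.
have al := a_le m (ltW L0).
have eE : expR (2 - L) = expR 2 / (s * s).
  by rewrite expRD expRN /L lnK ?posrE// ss.
have sL : L ^+ 4 / 2 ^+ 12 <= s.
  have L8 : 0 <= L / 8 by rewrite divr_ge0// ltW.
  have := expR_ge_pow 4 L8.
  have -> : (L / 8) *+ 4 = L / 2 by rewrite -mulr_natr; field.
  have -> : expR (L / 2) = s.
    have e0 : expR (L / 2) * expR (L / 2) = s * s.
      by rewrite -expRD ss -splitr /L lnK.
    move/eqP: e0; rewrite -!expr2 eqf_sqr => /orP[/eqP//|/eqP e0].
    by have := expR_gt0 (L / 2); rewrite e0 oppr_gt0 ltNge ltW.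
  by apply: le_trans; rewrite le_eqVlt; apply/orP; left; apply/eqP; field.
have tail : expR 2 / (s * s) <= c / (4 * s * L ^+ 3).
  rewrite ler_pdivrMr ?mulr_gt0//.
  have -> : c / (4 * s * L ^+ 3) * (s * s) = c * s / (4 * L ^+ 3).
    by field; rewrite !gt_eqF.
  rewrite ler_pdivlMr ?mulr_gt0//.
  apply: (@le_trans _ _ (c * (c^-1 * (4 * L ^+ 3 * expR 2)))).
    by rewrite [leRHS]mulrA mulfV ?gt_eqF// mul1r mulrC.
  rewrite ler_pM2l//.
  apply: le_trans sL; rewrite ler_pdivlMr ?exprn_gt0// (exprS L 3).
  have -> : c^-1 * (4 * L ^+ 3 * expR 2) * 2 ^+ 12 =
    2 ^+ 12 * (4 * expR 2) / c * L ^+ 3 by ring.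
  by rewrite ler_wpM2r// ltW.
have pL : c / (4 * s * L ^+ 3) <= L * p m.
  have e1 : c / (2 * s * L ^+ 3) = c / (4 * s * L ^+ 3) + c / (4 * s * L ^+ 3).
    by field; rewrite !gt_eqF.
  by move: am al tail; rewrite eE e1; lra.
have p1 : c / (4 * L ^+ 4) / s <= p m.
  rewrite -(ler_pM2l L0); apply: le_trans pL.
  by rewrite le_eqVlt; apply/orP; left; apply/eqP; field; rewrite !gt_eqF.
apply: le_trans p1; rewrite mulrC ler_pM2r ?invr_gt0//.
rewrite mulNr expRN -[leRHS]invrK lef_pV2 ?posrE ?expR_gt0//; last first.
  by rewrite invr_gt0 divr_gt0// mulr_gt0// exprn_gt0.
rewrite invf_div ler_pdivrMr//.
set t := Num.sqrt L.
have t0 : 0 <= t by rewrite sqrtr_ge0.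
have tt : t ^+ 2 = L by rewrite sqr_sqrtr// ltW.
have t2 : 0 <= t / 2 by rewrite divr_ge0.
have : (t / 2) ^+ 10 <= expR (5 * t).
  have -> : 5 * t = (t / 2) *+ 10 by rewrite -mulr_natr; field.
  exact: expR_ge_pow.
have -> : (t / 2) ^+ 10 = L ^+ 5 / 2 ^+ 10 by rewrite -tt -exprM; field.
move=> h; rewrite -ler_pdivrMr//; apply: le_trans h.
rewrite ler_pdivlMr ?exprn_gt0// (exprS L 4) -[leLHS]mulrA.
have -> : 4 * L ^+ 4 * (c^-1 * 2 ^+ 10) = 2 ^+ 12 / c * L ^+ 4 by ring.
by rewrite ler_wpM2r// exprn_ge0// ltW.
Qed.

Lemma near_ln_ge (K : R) : \forall n \near \oo, K <= ln n.+1%:R.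
Proof.
near=> n.
rewrite -[K]expRK ler_ln ?posrE ?expR_gt0// -natr1.
apply: (@le_trans _ _ n%:R); last by rewrite lerDl.
near: n; exact: nbhs_infty_ger.
Unshelve. all: by end_near. Qed.

Lemma persistence_bounds :
  exists k : R, 0 < k /\ \forall n \near \oo,
    n.+1%:R `^ (- 2^-1) * expR (- k * Num.sqrt (ln n.+1%:R)) <= p n /\
    p n <= n.+1%:R `^ (- 2^-1) * (ln n.+1%:R) `^ k.
Proof.
(* up to constants, the upper bound loses L^3 and the lower bound L^4 *)
exists 5; split => //.
have h1 := near_ln_ge 2.
have h2 := near_ln_ge (expR 1 * (4 * Num.sqrt C) + expR 2).
have h3 := near_ln_ge (8 * Num.sqrt C / c + 1).
have h4 := near_ln_ge (2 ^+ 12 / c).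
have h5 := near_ln_ge (2 ^+ 12 * (4 * expR 2) / c).
near=> n.
have L2 : 2 <= ln (n.+1%:R : R) by near: n.
have -> : n.+1%:R `^ (- 2^-1) = (Num.sqrt n.+1%:R)^-1 :> R.
  by rewrite powRN powR12_sqrt.
have -> : (ln n.+1%:R) `^ 5 = ln n.+1%:R ^+ 5 :> R.
  by rewrite powR_mulrn//; lra.
split.
  by apply: persistence_lower => //; near: n.
by apply: persistence_upper => //; near: n.
Unshelve. all: by end_near. Qed.

End persistence_asymptotics.

(** * Random walk in random scenery *)

Section canonical_coordinates.
Context {R : realType} {dT : measure_display} {T : measurableType dT}
  (P : probability T R) (d : nat)
  (S : nat -> {RV P >-> lattice d}) (xi : lattice d -> {RV P >-> R}).
Hypotheses (walkS : random_walk P S)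
  (gauss_xi : forall x (B : set R), measurable B ->
     distribution P (xi x) B = normal_prob 0 1 B)
  (indep_xi : mutually_independent P xi)
  (indep_xi_S : independent_families P xi S).
Notation scenery := (product_space (measurableTypeR R) (lattice d)).
Notation steps := (product_space (lattice d) nat).

Lemma measurable_increment dU (U : measurableType dU)
    (S' : nat -> U -> lattice d) n :
  (forall i, measurable_fun setT (S' i)) ->
  measurable_fun setT (increment S' n).
Proof.
move=> mS; apply: measurable_latticeD; first exact: mS.
exact: measurable_latticeN.
Qed.

Definition scenery_of (w : T) : scenery := fun x => xi x w.
Definition steps_of (w : T) : steps := fun n => increment S n.+1 w.

Lemma measurable_scenery_of : measurable_fun setT scenery_of.
Proof. by apply: measurable_product_space => x; exact: (measurable_funPT (xi x)). Qed.

Lemma measurable_steps_of : measurable_fun setT steps_of.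
Proof.
apply: measurable_product_space => n; apply: measurable_increment => i.
exact: measurable_funPT.
Qed.

HB.instance Definition _ :=
  isMeasurableFun.Build _ _ _ _ scenery_of measurable_scenery_of.
HB.instance Definition _ :=
  isMeasurableFun.Build _ _ _ _ steps_of measurable_steps_of.

Lemma measurable_step1 : measurable_fun setT (increment S 1 : T -> lattice d).
Proof. by apply: measurable_increment => i; exact: measurable_funPT. Qed.
HB.instance Definition _ :=
  isMeasurableFun.Build _ _ _ _ (increment S 1 : T -> lattice d) measurable_step1.

Definition scenery_law : probability scenery R := distribution P scenery_of.
Definition steps_law : probability steps R := distribution P steps_of.
Definition step_law : probability (lattice d) R := distribution P (increment S 1).

Lemma iid_scenery_law : iid_law (normal_prob 0 1) scenery_law.
Proof.
move=> J B mB.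
transitivity (P (\bigcap_(j in [set` J]) (xi j @^-1` B j))) => //.
rewrite (indep_xi (fun j _ => mB j)).
by apply: eq_bigr => x _; exact: (gauss_xi x (mB x)).
Qed.

Lemma iid_steps_law : iid_law step_law steps_law.
Proof.
move=> J B mB; have [_ [indS idS]] := walkS.
transitivity (P (\bigcap_(j in [set` J]) (increment S j.+1 @^-1` B j))) => //.
rewrite (indS _ _ (fun j _ => mB j)).
by apply: eq_bigr => n _; exact: (idS n 0%N).
Qed.

(** The independence of the scenery and the walk makes their joint law the
   product law; both canonical maps are measurable for the sigma-algebras
   generated by the two families. *)
Lemma joint_law (A : set (scenery * steps)) : measurable A ->
  (scenery_law \x steps_law)%E A = P ((fun w => (scenery_of w, steps_of w)) @^-1` A).
Proof.
move=> mA.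
have mj : measurable_fun setT (fun w => (scenery_of w, steps_of w)).
  apply: measurable_fun_pair; first exact: measurable_scenery_of.
  exact: measurable_steps_of.
pose j : {mfun T >-> (scenery * steps)%type} :=
  HB.pack (fun w => (scenery_of w, steps_of w)) (isMeasurableFun.Build _ _ _ _ _ mj).
apply: (@product_measure_unique _ _ _ _ _ scenery_law steps_law
  (distribution P j)) => // B C mB mC.
apply: (indep_xi_S (A := scenery_of @^-1` B) (B := steps_of @^-1` C)).
  pose U := g_sigma_algebraType
    (\bigcup_i preimage_set_system setT (xi i) measurable).
  have mU : measurable_fun setT (scenery_of : U -> scenery).
    apply: measurable_product_space => x _ D mD.
    apply: sub_sigma_algebra; exists x => //; exists D => //.
  by have := mU measurableT B mB; rewrite setTI.
pose U := g_sigma_algebraType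
  (\bigcup_i preimage_set_system setT (S i) measurable).
have mU : measurable_fun setT (steps_of : U -> steps).
  apply: measurable_product_space => n.
  apply: (@measurable_increment _ U (fun i w => S i w)) => i _ D mD.
  by apply: sub_sigma_algebra; exists i => //; exists D.
by have := mU measurableT C mC; rewrite setTI.
Qed.

Lemma position_steps_of w n : position (steps_of w) n = S n w.
Proof.
have [S0 _] := walkS.
elim: n => [|n IH]; first by rewrite position0 S0.
by rewrite /position big_ord_recr -/(position _ n) IH /= addrC subrK.
Qed.

Lemma rwrs_scenery_sum w n :
  rwrs xi S n w = scenery_sum (scenery_of w) (steps_of w) n.
Proof.
rewrite /rwrs big_add1 /= big_mkord; apply: eq_bigr => i _.
by rewrite position_steps_of.
Qed.

Lemma max_upto_le0 (f : nat -> R) m :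
  max_upto f m.+1 <= 0 <-> forall k, (k <= m)%N -> f k.+1 <= 0.
Proof.
rewrite /max_upto; split=> [h k km|h].
  apply: le_trans h; apply: le_bigmax_seq => //.
  by rewrite mem_index_iota.
rewrite big_seq; apply: bigmax_le; first exact: h.
by move=> [|k]; rewrite mem_index_iota// => /andP[_ km]; exact: h.
Qed.

Lemma persistenceE m :
  P [set w | max_upto (fun k => rwrs xi S k w) m.+1 <= 0] =
  persistence scenery_law steps_law m.
Proof.
rewrite /persistence joint_law; last exact: measurable_postmax_le.
congr (P _); apply/seteqP; split => w /=.
  by move=> /max_upto_le0 h; apply/postmax_le => k km; rewrite -rwrs_scenery_sum h.
move=> /postmax_le h; apply/max_upto_le0 => k km.
by rewrite rwrs_scenery_sum h.
Qed.

Lemma green_transient_le : transient P S ->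
  exists2 C : R, 0 < C & forall n, (0 < n)%N ->
    green steps_law n <= C * (1 + ln n%:R).
Proof.
move=> tS.
have [|C C0 h] := @transient_green_le _ _ _ _ iid_steps_law.
  apply: le_lt_trans tS.
  rewrite le_eqVlt; apply/orP; left; apply/eqP.
  congr (P _); apply/seteqP; split => w /=.
    by move=> [n [n0 hn]]; exists n; rewrite -position_steps_of.
  by move=> [n [n0 hn]]; exists n; rewrite position_steps_of.
exists C => // n n0; apply: (le_trans (h n)).
apply: ler_peMr; first exact: ltW.
by rewrite lerDl ln_ge0// ler1n.
Qed.

End canonical_coordinates.

Section planar_case.
Context {R : realType} {dT : measure_display} {T : measurableType dT}
  (P : probability T R) (S : nat -> {RV P >-> lattice 2}).
Hypothesis walkS : random_walk P S.

Lemma green_nonsingular_le :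
  finite_covariance P (S 1%N) -> covariance_mx P (S 1%N) \in unitmx ->
  exists2 C : R, 0 < C & forall n, (0 < n)%N ->
    green (steps_law S) n <= C * (1 + ln n%:R).
Proof.
move=> fS uS.
have [x0 [x1 [x2 [a0 a1 a2 nc]]]] := nonsingular_covariance_support fS uS.
have rE x : step_law S [set x] = P (S 1%N @^-1` [set x]).
  congr (P _); apply/seteqP; split => w /=; have [S0 _] := walkS;
    by rewrite /increment S0 subr0.
rewrite -!rE in a0 a1 a2.
have fin x : step_law S [set x] = (fine (step_law S [set x]))%:E.
  by rewrite fineK// fin_num_measure.
set u0 := fine (step_law S [set x0]); set u1 := fine (step_law S [set x1]).
set u2 := fine (step_law S [set x2]).
rewrite (fin x0) lte_fin -/u0 in a0; rewrite (fin x1) lte_fin -/u1 in a1.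
rewrite (fin x2) lte_fin -/u2 in a2.
pose p := Num.min 2^-1 (Num.min u0 (Num.min u1 u2)).
have p0 : 0 < p by rewrite !lt_min a0 a1 a2 invr_gt0 ltr0n.
have ph : p <= 2^-1 by rewrite /p ge_min lexx.
have p_0 : p <= u0 by rewrite /p !ge_min lexx orbT.
have p_1 : p <= u1 by rewrite /p !ge_min lexx !orbT.
have p_2 : p <= u2 by rewrite /p !ge_min lexx !orbT.
apply: (@planar_green_le _ _ _ _ (iid_steps_law walkS) x0 x1 x2 p) => //.
- by lra.
- by rewrite (fin x0) lee_fin.
- by rewrite (fin x1) lee_fin -/u1; lra.
- by rewrite (fin x2) lee_fin -/u2; lra.
Qed.

End planar_case.

Theorem theorem2 (R : realType) (dT : measure_display) (T : measurableType dT)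
    (P : probability T R) (d : nat)
    (S : nat -> {RV P >-> lattice d}) (xi : lattice d -> {RV P >-> R})
    (walkS : random_walk P S)
    (caseS :
       [/\ d = 2%N, centered P (S 1%N), finite_covariance P (S 1%N),
           covariance_mx P (S 1%N) \in unitmx & aperiodic P (S 1%N)]
       \/ ((1 <= d)%N /\ transient P S))
    (gauss_xi : forall x (B : set R), measurable B ->
       distribution P (xi x) B = normal_prob 0 1 B)
    (indep_xi : mutually_independent P xi)
    (indep_xi_S : independent_families P xi S) :
  exists c : R, 0 < c /\
    \forall N \near \oo,
      ((N%:R `^ (- 2^-1) * expR (- c * Num.sqrt (ln N%:R)))%:E
         <= P [set w | (max_upto (fun k => rwrs xi S k w) N <= 0)%R])%E /\
      (P [set w | (max_upto (fun k => rwrs xi S k w) N <= 0)%R]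
         <= (N%:R `^ (- 2^-1) * (ln N%:R) `^ c)%:E)%E.
Proof.
have gmu := iid_scenery_law gauss_xi indep_xi.
have rnu := iid_steps_law walkS.
set mu := scenery_law xi in gmu; set nu := steps_law S in rnu.
have [C C0 gC] : exists2 C : R, 0 < C & forall n, (0 < n)%N ->
    green nu n <= C * (1 + ln n%:R).
  case: caseS => [[d2 _ fS uS _]|[_ tS]]; last exact: green_transient_le.
  by subst d; exact: green_nonsingular_le.
pose e n := fine (mean_runmax mu nu n).
pose a m := fine (mean_overshoot mu nu m).
pose p m := fine (persistence mu nu m).
have lnn (n : nat) : (0 < n)%N -> 0 <= ln (n%:R : R).
  by move=> n0; rewrite ln_ge0// ler1n.
have e_le n : (0 < n)%N -> (mean_runmax mu nu n <=
    ((ln n%:R + 2) * Num.sqrt (2 * n%:R * (C * (1 + ln n%:R))))%:E)%E.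
  move=> n0; apply: (mean_runmax_le rnu gmu n0 _ (gC n n0)).
  by rewrite mulr_gt0// ltr_pwDl// lnn.
have e00 : mean_runmax mu nu 0 = 0%E.
  by apply: integral0_eq.
have e_ge0 n : (0 <= mean_runmax mu nu n)%E.
  by apply: integral_ge0 => w _; rewrite lee_fin runmax_ge0.
have a_ge0 m : (0 <= mean_overshoot mu nu m)%E.
  by apply: integral_ge0 => w _; rewrite lee_fin le_max lexx.
have eE n : mean_runmax mu nu n = (e n)%:E.
  rewrite fineK// ge0_fin_numE//; case: n => [|n]; first by rewrite e00 ltry.
  by apply: (le_lt_trans (e_le n.+1 isT)); rewrite ltry.
have eSE m := mean_runmaxS gmu rnu m.
have aE m : mean_overshoot mu nu m = (a m)%:E.
  rewrite fineK// ge0_fin_numE//.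
  apply: (@le_lt_trans _ _ (mean_runmax mu nu m.+1)); last by rewrite eE ltry.
  by rewrite eSE leeDr.
have pE m : persistence mu nu m = (p m)%:E.
  rewrite fineK// ge0_fin_numE ?measure_ge0//.
  apply: (le_lt_trans (persistence_le_mean_overshoot _ gmu m (lexx 1))).
  by rewrite aE -EFinM -EFinD ltry.
have [k [k0 hk]] : exists k : R, 0 < k /\ \forall n \near \oo,
    n.+1%:R `^ (- 2^-1) * expR (- k * Num.sqrt (ln n.+1%:R)) <= p n /\
    p n <= n.+1%:R `^ (- 2^-1) * (ln n.+1%:R) `^ k.
  apply: (@persistence_bounds R e a p C gaussian_constant).
  - exact: C0.
  - exact: gaussian_constant_gt0.
  - by move=> m; rewrite -lee_fin -aE.
  - by rewrite /e e00.
  - by move=> m; apply: EFin_inj; rewrite EFinD -!eE -aE eSE.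
  - by move=> m m' mm'; rewrite -lee_fin -!aE mean_overshoot_le.
  - by move=> n n0; rewrite -lee_fin -eE mean_runmax_ge.
  - by move=> n n0; rewrite -lee_fin -eE e_le.
  - move=> m A A1; rewrite -lee_fin EFinD EFinM -aE -pE.
    exact: persistence_le_mean_overshoot.
  - move=> m A A0; rewrite -lee_fin EFinD EFinM -aE -pE.
    exact: mean_overshoot_le_persistence.
exists k; split => //.
case: hk => N0 _ hk; exists N0.+1 => // -[//|n] /= n0.
have [h1 h2] := hk n n0.
by rewrite (persistenceE walkS indep_xi_S) -/mu -/nu pE !lee_fin.
Qed.
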